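(* Let $\mathcal{C}$ be a modular category over $k=\mathbb{C}$. Then the projective representation of $SL_2(\mathbb{Z})$ associated to $\mathcal{C}$ is unitary in the standard hermitian metric, i.e. the matrices $S$ and $T$ of $\mathcal{C}$ are unitary. (No hermitian or unitary structure on $\mathcal{C}$ is assumed.)
   Context: A fusion category over $\mathbb{C}$ is a $\mathbb{C}$-linear semisimple rigid tensor category with finitely many isomorphism classes of simple objects, finite dimensional spaces of morphisms, and $\operatorname{End}(\mathbf 1)=\mathbb{C}$. A ribbon fusion category is a fusion category with a braiding and a compatible twist $\theta$ (with $\theta_{V^*}=(\theta_V)^*$); it has a canonical spherical structure, with respect to which categorical dimensions $\dim(V)$ are defined. Let $X_i$, $i\in I$, be representatives of the simple objects, let $X_0=\mathbf 1$, let $X_i^*\cong X_{i^*}$, let $\theta_i\in\mathbb{C}^\times$ be the scalar by which the twist acts on $X_i$, and put $$\tilde s_{ij}=\theta_i^{-1}\theta_j^{-1}\sum_{k\in I}\dim_{\mathbb C}\operatorname{Hom}(X_k,X_{i^*}\otimes X_j)\,\theta_k\dim(X_k).$$ A modular category is a ribbon fusion category whose matrix $(\tilde s_{ij})$ is nondegenerate, together with a choice of square root $\sqrt{D}$ of the global dimension $D=\sum_i\dim(X_i)^2$. Its $S$-matrix is $S=(s_{ij})$, $s_{ij}=\tilde s_{ij}/\sqrt{D}$, and its $T$-matrix is the diagonal matrix with entries $\theta_i$. The assignment $\begin{pmatrix}0&-1\\1&0\end{pmatrix}\mapsto S$, $\begin{pmatrix}1&1\\0&1\end{pmatrix}\mapsto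 T$ defines the associated projective representation of $SL_2(\mathbb{Z})$ on $\mathbb{C}^I$, and the standard hermitian metric is that of $\mathbb{C}^I$. *)

(* Defs.v *)
From mathcomp Require Import all_boot all_order all_algebra.
From mathcomp Require Import spectral reals complex.

Set Implicit Arguments.
Unset Strict Implicit.
Unset Printing Implicit Defensive.

Import GRing.Theory Num.Theory.
Local Open Scope ring_scope.

(* Objects:   X ⊗ Y.        Morphisms: g ∘ f (f first), f ⊠ g (tensor product). *)
Reserved Notation "g ∘ f" (at level 40, left associativity).
Reserved Notation "X ⊗ Y" (at level 38, left associativity).
Reserved Notation "f ⊠ g" (at level 38, left associativity).

(** * Linear categories *)

(* [vectType K] is the type of finite dimensional K-vector spaces, so the
   spaces of morphisms are finite dimensional. *)
Record linear_category (K : fieldType) := LinearCategory {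
  obj :> Type;
  mor : obj -> obj -> vectType K;
  idm : forall X, mor X X;
  compm : forall X Y Z, mor Y Z -> mor X Y -> mor X Z
    where "g ∘ f" := (compm g f);
  compA : forall X Y Z W (h : mor Z W) (g : mor Y Z) (f : mor X Y),
    h ∘ (g ∘ f) = (h ∘ g) ∘ f;
  comp1m : forall X Y (f : mor X Y), idm Y ∘ f = f;
  compm1 : forall X Y (f : mor X Y), f ∘ idm X = f;
  comp_linear_l : forall X Y Z (f : mor X Y), linear (fun g : mor Y Z => g ∘ f);
  comp_linear_r : forall X Y Z (g : mor Y Z), linear (fun f : mor X Y => g ∘ f)
}.
Arguments mor {K l}.
Arguments idm {K l}.
Notation "g ∘ f" := (compm g f).

Record iso (K : fieldType) (C : linear_category K) (X Y : C) := Iso {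
  fwd : mor X Y;
  bwd : mor Y X;
  bwd_fwd : bwd ∘ fwd = idm X;
  fwd_bwd : fwd ∘ bwd = idm Y
}.

Section Abelian.
Variables (K : fieldType) (C : linear_category K).

Definition isomorphic (X Y : C) : Prop := inhabited (iso X Y).

Definition is_iso (X Y : C) (f : mor X Y) : Prop :=
  exists g : mor Y X, g ∘ f = idm X /\ f ∘ g = idm Y.

Definition mono (X Y : C) (f : mor X Y) : Prop :=
  forall Z (g h : mor Z X), f ∘ g = f ∘ h -> g = h.

Definition epi (X Y : C) (f : mor X Y) : Prop :=
  forall Z (g h : mor Y Z), g ∘ f = h ∘ f -> g = h.

Definition is_kernel (X Y Z : C) (f : mor X Y) (k : mor Z X) : Prop :=
  f ∘ k = 0 /\
  forall W (g : mor W X), f ∘ g = 0 -> exists! h : mor W Z, k ∘ h = g.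

Definition is_cokernel (X Y Z : C) (f : mor X Y) (q : mor Y Z) : Prop :=
  q ∘ f = 0 /\
  forall W (g : mor Y W), g ∘ f = 0 -> exists! h : mor Z W, h ∘ q = g.

(* The case n = 0 says that Y is a zero object. *)
Definition direct_sum (n : nat) (F : 'I_n -> C) (Y : C) : Prop :=
  exists (inc : forall i, mor (F i) Y) (prj : forall i, mor Y (F i)),
    [/\ forall i, prj i ∘ inc i = idm (F i),
        forall i j, i != j -> prj j ∘ inc i = 0
      & \sum_(i < n) inc i ∘ prj i = idm Y].

Definition additive_cat : Prop :=
  forall n (F : 'I_n -> C), exists Y, direct_sum F Y.

Definition abelian_cat : Prop :=
  [/\ additive_cat,
      forall (X Y : C) (f : mor X Y), exists Z (k : mor Z X), is_kernel f k,
      forall (X Y : C) (f : mor X Y), exists Z (q : mor Y Z), is_cokernel f q,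
      forall (X Y : C) (f : mor X Y), mono f ->
        exists Z (g : mor Y Z), is_kernel g f
    & forall (X Y : C) (f : mor X Y), epi f ->
        exists Z (g : mor Z X), is_cokernel g f].

(* X is nonzero and its only subobjects are 0 and X. *)
Definition simple_obj (X : C) : Prop :=
  idm X <> 0 /\ forall Y (m : mor Y X), mono m -> m = 0 \/ is_iso m.

Definition semisimple_cat : Prop :=
  abelian_cat /\
  forall X : C, exists n (F : 'I_n -> C),
    (forall i, simple_obj (F i)) /\ direct_sum F X.

Definition finitely_many_simples : Prop :=
  exists n (F : 'I_n -> C),
    forall X, simple_obj X -> exists i, isomorphic X (F i).

(* The coefficient of f along idm X: if f = a *: idm X with idm X != 0,
   this is a. *)
Definition scalar_of (X : C) (f : mor X X) : K := coord [tuple idm X] ord0 f.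

End Abelian.

(** * Tensor categories and duality *)

Record tensor_category (K : fieldType) := TensorCategory {
  tcat :> linear_category K;
  tunit : tcat;
  tens : tcat -> tcat -> tcat
    where "X ⊗ Y" := (tens X Y);
  tensm : forall (X X' Y Y' : tcat),
      mor X X' -> mor Y Y' -> mor (X ⊗ Y) (X' ⊗ Y')
    where "f ⊠ g" := (tensm f g);
  tensm1 : forall X Y, idm X ⊠ idm Y = idm (X ⊗ Y);
  tensm_comp : forall (X X' X'' Y Y' Y'' : tcat)
      (f' : mor X' X'') (f : mor X X') (g' : mor Y' Y'') (g : mor Y Y'),
    (f' ∘ f) ⊠ (g' ∘ g) = (f' ⊠ g') ∘ (f ⊠ g);
  tensm_linear_l : forall (X X' Y Y' : tcat) (g : mor Y Y'),
    linear (fun f : mor X X' => f ⊠ g);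
  tensm_linear_r : forall (X X' Y Y' : tcat) (f : mor X X'),
    linear (fun g : mor Y Y' => f ⊠ g);
  assoc : forall X Y Z, iso ((X ⊗ Y) ⊗ Z) (X ⊗ (Y ⊗ Z));
  lunit : forall X, iso (tunit ⊗ X) X;
  runit : forall X, iso (X ⊗ tunit) X;
  assoc_nat : forall (X X' Y Y' Z Z' : tcat)
      (f : mor X X') (g : mor Y Y') (h : mor Z Z'),
    fwd (assoc X' Y' Z') ∘ ((f ⊠ g) ⊠ h) = (f ⊠ (g ⊠ h)) ∘ fwd (assoc X Y Z);
  lunit_nat : forall (X X' : tcat) (f : mor X X'),
    fwd (lunit X') ∘ (idm tunit ⊠ f) = f ∘ fwd (lunit X);
  runit_nat : forall (X X' : tcat) (f : mor X X'),
    fwd (runit X') ∘ (f ⊠ idm tunit) = f ∘ fwd (runit X);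
  pentagon : forall X Y Z W,
    fwd (assoc X Y (Z ⊗ W)) ∘ fwd (assoc (X ⊗ Y) Z W) =
    (idm X ⊠ fwd (assoc Y Z W)) ∘ fwd (assoc X (Y ⊗ Z) W)
      ∘ (fwd (assoc X Y Z) ⊠ idm W);
  triangle : forall X Y,
    (idm X ⊠ fwd (lunit Y)) ∘ fwd (assoc X tunit Y) = fwd (runit X) ⊠ idm Y
}.
Arguments tunit {K t}.
Arguments assoc {K t}.
Arguments lunit {K t}.
Arguments runit {K t}.
Notation "X ⊗ Y" := (tens X Y).
Notation "f ⊠ g" := (tensm f g).

Definition is_left_dual (K : fieldType) (C : tensor_category K) (X X' : C)
    (ev : mor (X' ⊗ X) tunit) (coev : mor tunit (X ⊗ X')) : Prop :=
  fwd (runit X) ∘ (idm X ⊠ ev) ∘ fwd (assoc X X' X) ∘ (coev ⊠ idm X)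
    = fwd (lunit X) /\
  fwd (lunit X') ∘ (ev ⊠ idm X') ∘ bwd (assoc X' X X') ∘ (idm X' ⊠ coev)
    = fwd (runit X').

(* Left duals are chosen once and for all (they are unique up to a unique
   isomorphism); right duals are only required to exist. *)
Record rigid_category (K : fieldType) := RigidCategory {
  rcat :> tensor_category K;
  dual : rcat -> rcat;
  ev : forall X, mor (dual X ⊗ X) tunit;
  coev : forall X, mor tunit (X ⊗ dual X);
  left_dualP : forall X, is_left_dual (ev X) (coev X);
  right_dualP : forall X : rcat, exists (Y : rcat)
    (e : mor (X ⊗ Y) tunit) (c : mor tunit (Y ⊗ X)), is_left_dual e c
}.
Arguments ev {K r}.
Arguments coev {K r}.

Definition dualm (K : fieldType) (C : rigid_category K) (X Y : C)
    (f : mor X Y) : mor (dual Y) (dual X) :=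
  fwd (lunit (dual X)) ∘ (ev Y ⊠ idm (dual X))
    ∘ ((idm (dual Y) ⊠ f) ⊠ idm (dual X))
    ∘ bwd (assoc (dual Y) X (dual X))
    ∘ (idm (dual Y) ⊠ coev X) ∘ bwd (runit (dual Y)).

Record fusion_category (K : fieldType) := FusionCategory {
  fcat :> rigid_category K;
  fusion_semisimple : semisimple_cat fcat;
  fusion_finite : finitely_many_simples fcat;
  end_one : \dim {: mor (tunit : fcat) tunit} = 1%N
}.

(** * Ribbon categories *)

Record ribbon_fusion_category (K : fieldType) := RibbonFusionCategory {
  rfcat :> fusion_category K;
  braid : forall X Y : rfcat, iso (X ⊗ Y) (Y ⊗ X);
  braid_nat : forall (X X' Y Y' : rfcat) (f : mor X X') (g : mor Y Y'),
    fwd (braid X' Y') ∘ (f ⊠ g) = (g ⊠ f) ∘ fwd (braid X Y);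
  hexagon1 : forall X Y Z : rfcat,
    fwd (assoc Y Z X) ∘ fwd (braid X (Y ⊗ Z)) ∘ fwd (assoc X Y Z) =
    (idm Y ⊠ fwd (braid X Z)) ∘ fwd (assoc Y X Z) ∘ (fwd (braid X Y) ⊠ idm Z);
  hexagon2 : forall X Y Z : rfcat,
    bwd (assoc Z X Y) ∘ fwd (braid (X ⊗ Y) Z) ∘ bwd (assoc X Y Z) =
    (fwd (braid X Z) ⊠ idm Y) ∘ bwd (assoc X Z Y) ∘ (idm X ⊠ fwd (braid Y Z));
  twist : forall X : rfcat, iso X X;
  twist_nat : forall (X Y : rfcat) (f : mor X Y),
    fwd (twist Y) ∘ f = f ∘ fwd (twist X);
  twist_tens : forall X Y : rfcat,
    fwd (twist (X ⊗ Y)) =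
    fwd (braid Y X) ∘ fwd (braid X Y) ∘ (fwd (twist X) ⊠ fwd (twist Y));
  twist_dual : forall X : rfcat, fwd (twist (dual X)) = dualm (fwd (twist X))
}.
Arguments braid {K r}.
Arguments twist {K r}.

Section Ribbon.
Variables (K : fieldType) (C : ribbon_fusion_category K).

(* The Drinfeld isomorphism
   X -> X ⊗ (X* ⊗ X** ) -> (X* ⊗ X) ⊗ X** -> X**. *)
Definition drinfeld (X : C) : mor X (dual (dual X)) :=
  fwd (lunit (dual (dual X))) ∘ (ev X ⊠ idm (dual (dual X)))
    ∘ (fwd (braid X (dual X)) ⊠ idm (dual (dual X)))
    ∘ bwd (assoc X (dual X) (dual (dual X)))
    ∘ (idm X ⊠ coev (dual X)) ∘ bwd (runit X).

(* The canonical spherical structure of a ribbon category. *)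
Definition spherical (X : C) : mor X (dual (dual X)) :=
  drinfeld X ∘ fwd (twist X).

Definition cat_dim (X : C) : K :=
  scalar_of (ev (dual X) ∘ (spherical X ⊠ idm (dual X)) ∘ coev X).

(* Representatives X_i, i in I = {0, ..., n}, of the simple objects, together
   with the involution i |-> i* of I. *)
Record simple_reps (n : nat) := SimpleReps {
  rep :> 'I_n.+1 -> C;
  rep_simple : forall i, simple_obj (rep i);
  rep_inj : forall i j, isomorphic (rep i) (rep j) -> i = j;
  rep_full : forall Y : C, simple_obj Y -> exists i, isomorphic Y (rep i);
  rep_one : rep ord0 = tunit;
  star : 'I_n.+1 -> 'I_n.+1;
  rep_star : forall i, isomorphic (dual (rep i)) (rep (star i))
}.

Variables (n : nat) (X : simple_reps n).

Definition theta (i : 'I_n.+1) : K := scalar_of (fwd (twist (X i))).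

Definition stilde : 'M[K]_n.+1 := \matrix_(i, j)
  ((theta i)^-1 * (theta j)^-1 *
   \sum_k (\dim {: mor (X k) (X (star X i) ⊗ X j)})%:R
          * theta k * cat_dim (X k)).

Definition global_dim : K := \sum_i cat_dim (X i) ^+ 2.

End Ribbon.

(** * Modular categories *)

Record modular_category (K : fieldType) := ModularCategory {
  mcat :> ribbon_fusion_category K;
  rank_pred : nat;
  simples : simple_reps mcat rank_pred;
  stilde_nondegenerate : stilde simples \in unitmx;
  sqrtD : K;
  sqrtD_sqr : sqrtD ^+ 2 = global_dim simples
}.

Section Modular.
Variables (K : fieldType) (C : modular_category K).

Definition Smatrix : 'M[K]_((rank_pred C).+1) :=
  \matrix_(i, j) (stilde (simples C) i j / sqrtD C).

Definition Tmatrix : 'M[K]_((rank_pred C).+1) :=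
  diag_mx (\row_i theta (simples C) i).

End Modular.

(** * Projective representations of SL_2(Z) *)

Definition SL2Z (g : 'M[int]_2) : Prop := \det g = 1.

Definition sl2_s : 'M[int]_2 :=
  \matrix_(i, j) nth 0 (nth [::] [:: [:: 0; -1]; [:: 1; 0]] i) j.
Definition sl2_t : 'M[int]_2 :=
  \matrix_(i, j) nth 0 (nth [::] [:: [:: 1; 1]; [:: 0; 1]] i) j.

Section ProjectiveRep.
Variables (K : fieldType) (n : nat).

Definition proj_eq (A B : 'M[K]_n) : Prop := exists2 c : K, c != 0 & A = c *: B.

(* A projective representation is given by a choice of matrices representing
   the elements of PGL_n; the values outside SL_2(Z) are irrelevant. *)
Definition projective_rep (rho : 'M[int]_2 -> 'M[K]_n) : Prop :=
  (forall g, SL2Z g -> rho g \in unitmx) /\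
  (forall g h, SL2Z g -> SL2Z h -> proj_eq (rho (g *m h)) (rho g *m rho h)).

End ProjectiveRep.

Definition associated_rep (K : fieldType) (C : modular_category K)
    (rho : 'M[int]_2 -> 'M[K]_((rank_pred C).+1)) : Prop :=
  [/\ projective_rep rho,
      proj_eq (rho sl2_s) (Smatrix C) & proj_eq (rho sl2_t) (Tmatrix C)].

(* Every element of SL_2(Z) acts by the class of a unitary matrix. *)
Definition unitary_rep (K : numClosedFieldType) (n : nat)
    (rho : 'M[int]_2 -> 'M[K]_n) : Prop :=
  forall g, SL2Z g -> exists2 U : 'M[K]_n, U \is unitarymx & proj_eq (rho g) U.

(* Main.v *)
Require Import Defs.
From mathcomp Require Import all_boot all_order all_algebra.
From mathcomp Require Import spectral reals complex.
From mathcomp Require Import ring zify.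
From HB Require Import structures.
Import Defs passmx.

Set Implicit Arguments.
Unset Strict Implicit.
Unset Printing Implicit Defensive.

Import Order.TTheory GRing.Theory Num.Theory.
Local Open Scope ring_scope.

(** Write X_i for the simple objects, d_i for their dimensions, and let
    phi_i Y be the scalar by which a loop coloured by Y, linked around a
    strand coloured by X_i, acts on that strand.  Two nested loops show that
    phi_i is multiplicative in Y (fusion_char_tens), and cyclicity of the trace
    that it is additive (fusion_char_additive), so phi_i is a character of the
    fusion ring.  The trace of the double braiding of X_i and X_j is symmetric
    in i and j and equals d_i phi_i X_j (tr_double_braid).  Balancing expresses
    the twist of a tensor product by the double braiding, and turns the
    definition of the S-matrix into stilde_ij = d_i' phi_i' X_j with
    i' = star i (stildeE).

    Unitarity of S is then a statement about characters
    (fusion_characters_unitary).  By Frobenius reciprocity, multiplication by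
    X_i' is the transpose of multiplication by X_i in the basis of simple
    objects.  Pairing two characters in the hermitian metric therefore gives
    phi_i X_j' = conj (phi_i X_j) and the orthogonality of distinct characters;
    nondegeneracy makes the characters distinct and the dimensions nonzero.
    The matrix B with entries d_i phi_i X_j is symmetric with orthogonal rows,
    so B conj(B) is diagonal and commutes with B, which has no zero in its first
    row: all rows of B have the same norm.  Since d_i' = d_i, the vector of
    dimensions is real up to a common factor, and the square of that norm is
    the absolute value of the global dimension.

    Unitarity of T is the archimedean part of Vafa's argument.  On the space of
    morphisms from X to X (x) (X' (x) X), with X simple of twist t, the lantern
    relation writes t^4 as a product of three operators whose eigenvalues are
    twists of simple objects.  If |t| is the largest absolute value of a twist
    and N > 0 the dimension of the space, determinants give
    |t|^(4N) <= |t|^(3N), so |t| <= 1; the smallest one is treated in the same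
    way with 1/|t| (twist_norm1).  Finally SL_2(Z) is generated by the two
    matrices that are sent to S and T (SL2Z_generated).

    The graphical calculus is carried out without strictification: every
    diagram is drawn to the left of an arbitrary object R, with objects bracketed
    to the right, as in X (x) (Y (x) R).  In this suffixed form, where cap, cup
    and cr stand for caps, cups and crossings, associativity isomorphisms
    disappear from isotopy arguments, which are rewritings by naturality,
    by sliding a strand across a cap or cup, and by the Yang-Baxter relation. *)

Reserved Notation "X ◁ f" (at level 38, left associativity).
Reserved Notation "f ▷ X" (at level 38, left associativity).

(** * Linear categories *)

Section LinearCategory.
Variables (K : fieldType) (C : linear_category K).
Implicit Types X Y Z W : C.

Lemma compmDl X Y Z (g h : mor Y Z) (f : mor X Y) :
  (g + h) ∘ f = g ∘ f + h ∘ f.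
Proof. by have := comp_linear_l f 1 g h; rewrite !scale1r. Qed.

Lemma compmDr X Y Z (g : mor Y Z) (f h : mor X Y) :
  g ∘ (f + h) = g ∘ f + g ∘ h.
Proof. by have := comp_linear_r g 1 f h; rewrite !scale1r. Qed.

Lemma comp0m X Y Z (f : mor X Y) : (0 : mor Y Z) ∘ f = 0.
Proof. by apply: (addrI (0 ∘ f)); rewrite -compmDl !addr0. Qed.

Lemma compm0 X Y Z (g : mor Y Z) : g ∘ (0 : mor X Y) = 0.
Proof. by apply: (addrI (g ∘ 0)); rewrite -compmDr !addr0. Qed.

Lemma compmZl X Y Z a (g : mor Y Z) (f : mor X Y) :
  (a *: g) ∘ f = a *: (g ∘ f).
Proof. by have := comp_linear_l f a g 0; rewrite comp0m !addr0. Qed.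

Lemma compmZr X Y Z a (g : mor Y Z) (f : mor X Y) :
  g ∘ (a *: f) = a *: (g ∘ f).
Proof. by have := comp_linear_r g a f 0; rewrite compm0 !addr0. Qed.

Lemma compm_suml X Y Z (I : finType) (P : pred I) (g : I -> mor Y Z)
    (f : mor X Y) :
  (\sum_(i | P i) g i) ∘ f = \sum_(i | P i) g i ∘ f.
Proof.
by apply: (big_morph (fun g => g ∘ f)) => [g1 g2|]; rewrite ?compmDl ?comp0m.
Qed.

Lemma compm_sumr X Y Z (I : finType) (P : pred I) (g : mor Y Z)
    (f : I -> mor X Y) :
  g ∘ (\sum_(i | P i) f i) = \sum_(i | P i) g ∘ f i.
Proof.
by apply: (big_morph (fun f => g ∘ f)) => [f1 f2|]; rewrite ?compmDr ?compm0.
Qed.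

(** Composites are kept nested to the right; this form of an equation between
    composites applies in front of any further morphism. *)
Lemma tail2 X Y Z (g : mor Y Z) (f : mor X Y) h :
  g ∘ f = h -> forall W (z : mor W X), g ∘ (f ∘ z) = h ∘ z.
Proof. by move=> <- W z; rewrite compA. Qed.

Lemma tail3 X Y Z T (k : mor Z T) (g : mor Y Z) (f : mor X Y) h :
  k ∘ (g ∘ f) = h -> forall W (z : mor W X), k ∘ (g ∘ (f ∘ z)) = h ∘ z.
Proof. by move=> <- W z; rewrite !compA. Qed.

Lemma fbK X Y (u : iso X Y) W (z : mor W Y) : fwd u ∘ (bwd u ∘ z) = z.
Proof. by rewrite compA fwd_bwd comp1m. Qed.

Lemma bfK X Y (u : iso X Y) W (z : mor W X) : bwd u ∘ (fwd u ∘ z) = z.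
Proof. by rewrite compA bwd_fwd comp1m. Qed.

Lemma iso_epi X Y W (u : iso X Y) (g h : mor Y W) :
  g ∘ fwd u = h ∘ fwd u -> g = h.
Proof.
by move=> e; rewrite -[g]compm1 -[h]compm1 -(fwd_bwd u) !compA e.
Qed.

Lemma iso_mono X Y W (u : iso X Y) (g h : mor W X) :
  fwd u ∘ g = fwd u ∘ h -> g = h.
Proof. by move=> e; rewrite -(bfK u g) -(bfK u h) e. Qed.

Lemma iso_move X Y X' Y' (u : iso X X') (v : iso Y Y') (f : mor X Y)
    (g : mor X' Y') :
  fwd v ∘ f = g ∘ fwd u -> f ∘ bwd u = bwd v ∘ g.
Proof.
by move=> e; rewrite -[LHS](bfK v) (tail2 e) -compA fwd_bwd compm1.
Qed.

Definition iso_sym X Y (u : iso X Y) : iso Y X :=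
  Iso (fwd_bwd u) (bwd_fwd u).

End LinearCategory.

(** * Coherence *)

Notation "X ◁ f" := (idm X ⊠ f).
Notation "f ▷ X" := (f ⊠ idm X).

Section Tensor.
Variables (K : fieldType) (C : tensor_category K).
Implicit Types X Y Z W R Q : C.
Local Notation a X Y Z := (fwd (assoc X Y Z)).
Local Notation a' X Y Z := (bwd (assoc X Y Z)).
Local Notation l X := (fwd (lunit X)).
Local Notation l' X := (bwd (lunit X)).
Local Notation r X := (fwd (runit X)).
Local Notation r' X := (bwd (runit X)).
Local Notation "1" := (tunit (t := C)).

Lemma tensmDl X X' Y Y' (f g : mor X X') (h : mor Y Y') :
  (f + g) ⊠ h = f ⊠ h + g ⊠ h.
Proof. by have := tensm_linear_l h 1%R f g; rewrite !scale1r. Qed.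

Lemma tensmDr X X' Y Y' (f : mor X X') (g h : mor Y Y') :
  f ⊠ (g + h) = f ⊠ g + f ⊠ h.
Proof. by have := tensm_linear_r f 1%R g h; rewrite !scale1r. Qed.

Lemma tens0m X X' Y Y' (h : mor Y Y') : (0 : mor X X') ⊠ h = 0.
Proof. by apply: (addrI (0 ⊠ h)); rewrite -tensmDl !addr0. Qed.

Lemma tensm0 X X' Y Y' (f : mor X X') : f ⊠ (0 : mor Y Y') = 0.
Proof. by apply: (addrI (f ⊠ 0)); rewrite -tensmDr !addr0. Qed.

Lemma tensmZl X X' Y Y' c (f : mor X X') (h : mor Y Y') :
  (c *: f) ⊠ h = c *: (f ⊠ h).
Proof. by have := tensm_linear_l h c f 0; rewrite tens0m !addr0. Qed.

Lemma tensmZr X X' Y Y' c (f : mor X X') (h : mor Y Y') :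
  f ⊠ (c *: h) = c *: (f ⊠ h).
Proof. by have := tensm_linear_r f c h 0; rewrite tensm0 !addr0. Qed.

Lemma wlM X Y Y' Y'' (g : mor Y' Y'') (f : mor Y Y') :
  X ◁ (g ∘ f) = (X ◁ g) ∘ (X ◁ f).
Proof. by rewrite -tensm_comp comp1m. Qed.

Lemma wrM Y X X' X'' (g : mor X' X'') (f : mor X X') :
  (g ∘ f) ▷ Y = (g ▷ Y) ∘ (f ▷ Y).
Proof. by rewrite -tensm_comp comp1m. Qed.

Lemma exch X X' Y Y' (f : mor X X') (g : mor Y Y') :
  (f ▷ Y') ∘ (X ◁ g) = (X' ◁ g) ∘ (f ▷ Y).
Proof. by rewrite -!tensm_comp !comp1m !compm1. Qed.

Lemma tensE X X' Y Y' (f : mor X X') (g : mor Y Y') :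
  f ⊠ g = (f ▷ Y') ∘ (X ◁ g).
Proof. by rewrite -!tensm_comp comp1m compm1. Qed.

Lemma wl_iso_bf X Y Z (u : iso Y Z) :
  (X ◁ bwd u) ∘ (X ◁ fwd u) = idm (X ⊗ Y).
Proof. by rewrite -wlM bwd_fwd tensm1. Qed.
Lemma wl_iso_fb X Y Z (u : iso Y Z) :
  (X ◁ fwd u) ∘ (X ◁ bwd u) = idm (X ⊗ Z).
Proof. by rewrite -wlM fwd_bwd tensm1. Qed.
Definition wl_iso X Y Z (u : iso Y Z) : iso (X ⊗ Y) (X ⊗ Z) :=
  Iso (wl_iso_bf X u) (wl_iso_fb X u).

Lemma wr_iso_bf X Y Z (u : iso Y Z) :
  (bwd u ▷ X) ∘ (fwd u ▷ X) = idm (Y ⊗ X).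
Proof. by rewrite -wrM bwd_fwd tensm1. Qed.
Lemma wr_iso_fb X Y Z (u : iso Y Z) :
  (fwd u ▷ X) ∘ (bwd u ▷ X) = idm (Z ⊗ X).
Proof. by rewrite -wrM fwd_bwd tensm1. Qed.
Definition wr_iso X Y Z (u : iso Y Z) : iso (Y ⊗ X) (Z ⊗ X) :=
  Iso (wr_iso_bf X u) (wr_iso_fb X u).

Lemma aL X X' Y Z (f : mor X X') :
  a X' Y Z ∘ ((f ▷ Y) ▷ Z) = (f ▷ (Y ⊗ Z)) ∘ a X Y Z.
Proof. by rewrite assoc_nat tensm1. Qed.
Lemma aM X Y Y' Z (f : mor Y Y') :
  a X Y' Z ∘ ((X ◁ f) ▷ Z) = (X ◁ (f ▷ Z)) ∘ a X Y Z.
Proof. by rewrite assoc_nat. Qed.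
Lemma aR X Y Z Z' (f : mor Z Z') :
  a X Y Z' ∘ ((X ⊗ Y) ◁ f) = (X ◁ (Y ◁ f)) ∘ a X Y Z.
Proof. by rewrite -assoc_nat tensm1. Qed.

Lemma a'M X Y Y' Z (f : mor Y Y') :
  a' X Y' Z ∘ (X ◁ (f ▷ Z)) = ((X ◁ f) ▷ Z) ∘ a' X Y Z.
Proof. by rewrite (iso_move (aM _ _ f)). Qed.
Lemma a'R X Y Z Z' (f : mor Z Z') :
  a' X Y Z' ∘ (X ◁ (Y ◁ f)) = ((X ⊗ Y) ◁ f) ∘ a' X Y Z.
Proof. by rewrite (iso_move (aR _ _ f)). Qed.

Lemma l'N X Y (f : mor X Y) : (1 ◁ f) ∘ l' X = l' Y ∘ f.
Proof. by rewrite (iso_move (lunit_nat f)). Qed.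
Lemma wl1_inj X Y (f g : mor X Y) : 1 ◁ f = 1 ◁ g -> f = g.
Proof. by move=> e; apply: (iso_epi (u := lunit X)); rewrite -!lunit_nat e. Qed.
Lemma wr1_inj X Y (f g : mor X Y) : f ▷ 1 = g ▷ 1 -> f = g.
Proof. by move=> e; apply: (iso_epi (u := runit X)); rewrite -!runit_nat e. Qed.

(** Kelly's redundancy of this triangle: whisker with the unit and compare the
    two ways around the pentagon on 1, 1, X, Y. *)
Lemma lunit_assoc X Y : l (X ⊗ Y) ∘ a 1 X Y = l X ▷ Y.
Proof.
apply: wl1_inj; apply: (iso_epi (u := assoc 1 (1 ⊗ X) Y)).
apply: (iso_epi (u := wr_iso Y (assoc 1 1 X))) => /=.
have := pentagon 1 1 X Y; rewrite -?compA => e.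
rewrite wlM -?compA -e (tail2 (triangle _ _)) -aL -triangle wrM.
by rewrite (tail2 (aM _ _ _)) -?compA.
Qed.

Lemma lunit'_assoc X Y : a 1 X Y ∘ (l' X ▷ Y) = l' (X ⊗ Y).
Proof.
apply: (iso_mono (u := lunit (X ⊗ Y))); rewrite compA lunit_assoc fwd_bwd.
exact: (wr_iso_fb Y (lunit X)).
Qed.

Lemma triangle' X Y : a X 1 Y ∘ (r' X ▷ Y) = X ◁ l' Y.
Proof.
apply: (iso_mono (u := wl_iso X (lunit Y))) => /=; rewrite compA triangle.
by rewrite (wr_iso_fb Y (runit X)) (wl_iso_fb X (lunit Y)).
Qed.

(** The actions of a morphism on two strands, of a coevaluation and of an
    evaluation, with R on their right. They are locked because their bodies
    are composites, which reassociation would otherwise look through. *)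
Definition suf X Y Z W (g : mor (X ⊗ Y) (Z ⊗ W)) R :
    mor (X ⊗ (Y ⊗ R)) (Z ⊗ (W ⊗ R)) :=
  locked (a Z W R ∘ ((g ▷ R) ∘ a' X Y R)).
Definition cup X Y (k : mor 1 (X ⊗ Y)) R : mor R (X ⊗ (Y ⊗ R)) :=
  locked (a X Y R ∘ ((k ▷ R) ∘ l' R)).
Definition cap X Y (h : mor (X ⊗ Y) 1) R : mor (X ⊗ (Y ⊗ R)) R :=
  locked (l R ∘ ((h ▷ R) ∘ a' X Y R)).

Lemma sufE X Y Z W (g : mor (X ⊗ Y) (Z ⊗ W)) R :
  suf g R = a Z W R ∘ ((g ▷ R) ∘ a' X Y R).
Proof. by rewrite /suf -lock. Qed.
Lemma cupE X Y (k : mor 1 (X ⊗ Y)) R : cup k R = a X Y R ∘ ((k ▷ R) ∘ l' R).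
Proof. by rewrite /cup -lock. Qed.
Lemma capE X Y (h : mor (X ⊗ Y) 1) R : cap h R = l R ∘ ((h ▷ R) ∘ a' X Y R).
Proof. by rewrite /cap -lock. Qed.

Section SuffixNaturality.
Variables (R R' : C) (f : mor R R').

Lemma sufN X Y Z W (g : mor (X ⊗ Y) (Z ⊗ W)) :
  suf g R' ∘ (X ◁ (Y ◁ f)) = (Z ◁ (W ◁ f)) ∘ suf g R.
Proof.
by rewrite !sufE -?compA a'R (tail2 (exch _ _)) -?compA (tail2 (aR _ _ _)) -?compA.
Qed.

Lemma cupN X Y (k : mor 1 (X ⊗ Y)) :
  cup k R' ∘ f = (X ◁ (Y ◁ f)) ∘ cup k R.
Proof.
by rewrite !cupE -?compA -l'N (tail2 (exch _ _)) -?compA (tail2 (aR _ _ _)) -?compA.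
Qed.

Lemma capN X Y (h : mor (X ⊗ Y) 1) :
  cap h R' ∘ (X ◁ (Y ◁ f)) = f ∘ cap h R.
Proof.
by rewrite !capE -?compA a'R (tail2 (exch _ _)) -?compA (tail2 (lunit_nat _)) -?compA.
Qed.

End SuffixNaturality.

Lemma suf_assoc X Y Z W (g : mor (X ⊗ Y) (Z ⊗ W)) R :
  suf g R ∘ a X Y R = a Z W R ∘ (g ▷ R).
Proof. by rewrite !sufE -!compA bwd_fwd compm1. Qed.

Lemma sufM X Y Z W Z' W' (g : mor (Z ⊗ W) (Z' ⊗ W')) (f : mor (X ⊗ Y) (Z ⊗ W)) R :
  suf (g ∘ f) R = suf g R ∘ suf f R.
Proof. by rewrite !sufE wrM -?compA bfK. Qed.
Lemma suf_cup X Y Z W (g : mor (X ⊗ Y) (Z ⊗ W)) k R :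
  cup (g ∘ k) R = suf g R ∘ cup k R.
Proof. by rewrite !sufE !cupE wrM -?compA bfK. Qed.
Lemma suf_cap X Y Z W (g : mor (X ⊗ Y) (Z ⊗ W)) h R :
  cap (h ∘ g) R = cap h R ∘ suf g R.
Proof. by rewrite !sufE !capE wrM -?compA bfK. Qed.
Lemma suf1 X Y R : suf (idm (X ⊗ Y)) R = idm _.
Proof. by rewrite !sufE tensm1 comp1m fwd_bwd. Qed.
Lemma suf_wr X X' Y (f : mor X X') R : suf (f ▷ Y) R = f ▷ (Y ⊗ R).
Proof. by rewrite !sufE (tail2 (aL _ _ _)) -compA fwd_bwd compm1. Qed.
Lemma suf_wl X Y Y' (f : mor Y Y') R : suf (X ◁ f) R = X ◁ (f ▷ R).
Proof. by rewrite !sufE (tail2 (aM _ _ _)) -compA fwd_bwd compm1. Qed.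
Lemma sufZ X Y Z W c (g : mor (X ⊗ Y) (Z ⊗ W)) R : suf (c *: g) R = c *: suf g R.
Proof. by rewrite !sufE tensmZl compmZl compmZr. Qed.

Lemma pentagon' X Y R Q :
  a X Y (R ⊗ Q) ∘ a (X ⊗ Y) R Q =
  (X ◁ a Y R Q) ∘ (a X (Y ⊗ R) Q ∘ (a X Y R ▷ Q)).
Proof. by rewrite pentagon !compA. Qed.

(** The pentagon in the form that moves a bracketing of the suffix past the
    bracketing of the two active strands. *)
Lemma pentagon_inv X Y R Q :
  a (X ⊗ Y) R Q ∘ (a' X Y R ▷ Q) =
  a' X Y (R ⊗ Q) ∘ ((X ◁ a Y R Q) ∘ a X (Y ⊗ R) Q).
Proof.
apply: (iso_mono (u := assoc X Y (R ⊗ Q))); rewrite fbK compA pentagon' -?compA.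
by rewrite (wr_iso_fb Q (assoc X Y R)) compm1.
Qed.

(** Suffixed morphisms act on the two left factors alone, so enlarging the
    suffix by Q is tensoring with Q. This and the two following lemmas state
    it with the associators that compare both sides. *)
Lemma suf_tens X Y Z W (g : mor (X ⊗ Y) (Z ⊗ W)) R Q :
  (Z ◁ a W R Q) ∘ (a Z (W ⊗ R) Q ∘ (suf g R ▷ Q)) =
  suf g (R ⊗ Q) ∘ ((X ◁ a Y R Q) ∘ a X (Y ⊗ R) Q).
Proof.
rewrite !sufE !wrM -?compA (tail3 (esym (pentagon' _ _ _ _))) -?compA.
by rewrite (tail2 (aL _ _ _)) -?compA pentagon_inv.
Qed.

Lemma cup_tens X Y (k : mor 1 (X ⊗ Y)) R Q :
  (X ◁ a Y R Q) ∘ (a X (Y ⊗ R) Q ∘ (cup k R ▷ Q)) = cup k (R ⊗ Q).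
Proof.
rewrite !cupE !wrM -?compA (tail3 (esym (pentagon' _ _ _ _))) -?compA.
by rewrite (tail2 (aL _ _ _)) -?compA lunit'_assoc.
Qed.

Lemma cap_tens X Y (h : mor (X ⊗ Y) 1) R Q :
  cap h R ▷ Q = cap h (R ⊗ Q) ∘ ((X ◁ a Y R Q) ∘ a X (Y ⊗ R) Q).
Proof.
by rewrite !capE !wrM -?compA -pentagon_inv -lunit_assoc -?compA (tail2 (aL _ _ _)) -?compA.
Qed.

(** The suffix R = 1 determines a morphism, so identities of plain morphisms
    may be checked in suffixed form. *)
Lemma cap_inj X Y (h h' : mor (X ⊗ Y) 1) : (forall R, cap h R = cap h' R) -> h = h'.
Proof.
move=> e; apply: wr1_inj; apply: (iso_epi (u := iso_sym (assoc X Y 1))).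
by apply: (iso_mono (u := lunit 1)); rewrite /= -!capE.
Qed.
Lemma cup_inj X Y (k k' : mor 1 (X ⊗ Y)) : (forall R, cup k R = cup k' R) -> k = k'.
Proof.
move=> e; apply: wr1_inj; apply: (iso_epi (u := iso_sym (lunit 1))).
by apply: (iso_mono (u := assoc X Y 1)); rewrite /= -!cupE.
Qed.

(** The duality axioms have the strand X alone; tensoring with R and moving
    the brackets by the pentagon and the triangle gives them with any suffix. *)
Lemma left_dual_zig X X' (e : mor (X' ⊗ X) 1) (k : mor 1 (X ⊗ X')) :
  is_left_dual e k -> forall R, (X ◁ cap e R) ∘ cup k (X ⊗ R) = idm (X ⊗ R).
Proof.
case=> H _ R; have {}H := congr1 (fun f => f ▷ R) H.
apply: (iso_epi (u := lunit (X ⊗ R))); apply: (iso_epi (u := assoc 1 X R)).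
rewrite comp1m lunit_assoc -{}H !wrM -triangle cupE capE !wlM -?compA bfK -aL.
rewrite (tail2 (aM _ _ _)) -?compA (tail2 (pentagon' _ _ _ _)) -?compA.
by rewrite (tail2 (wl_iso_bf X (assoc X' X R))) comp1m.
Qed.

Lemma left_dual_zag X X' (e : mor (X' ⊗ X) 1) (k : mor 1 (X ⊗ X')) :
  is_left_dual e k -> forall R, cap e (X' ⊗ R) ∘ (X' ◁ cup k R) = idm (X' ⊗ R).
Proof.
case=> _ H R; have {}H := congr1 (fun f => f ▷ R) H.
apply: (iso_epi (u := wl_iso X' (lunit R))); apply: (iso_epi (u := assoc X' 1 R)).
move: H; rewrite /= comp1m -compA triangle => <-.
rewrite !wrM -lunit_assoc cupE capE !wlM -?compA.
rewrite (tail2 (wl_iso_bf X' (lunit R))) comp1m -aM.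
rewrite (tail2 (aL _ _ _)) -?compA; do 2 congr (_ ∘ _).
by rewrite (tail2 (pentagon_inv _ _ _ _)) -?compA.
Qed.
End Tensor.

(** * Braiding *)

Section Braiding.
Variables (K : fieldType) (C : ribbon_fusion_category K).
Implicit Types X Y Z W R A : C.
Local Notation a X Y Z := (fwd (assoc X Y Z)).
Local Notation a' X Y Z := (bwd (assoc X Y Z)).
Local Notation l X := (fwd (lunit X)).
Local Notation l' X := (bwd (lunit X)).
Local Notation r X := (fwd (runit X)).
Local Notation r' X := (bwd (runit X)).
Local Notation c X Y := (fwd (braid X Y)).
Local Notation "1" := (tunit (t := C)).

Lemma braid_wr X X' Y (f : mor X X') : c X' Y ∘ (f ▷ Y) = (Y ◁ f) ∘ c X Y.
Proof. by rewrite braid_nat. Qed.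
Lemma braid_wl X Y Y' (f : mor Y Y') : c X Y' ∘ (X ◁ f) = (f ▷ X) ∘ c X Y.
Proof. by rewrite braid_nat. Qed.

(** The hexagon for X, 1, 1 and naturality with respect to the left unit force
    the braiding with the unit to be trivial; braid_unitl is the mirror image.
    *)
Lemma braid_unitr X : l X ∘ c X 1 = r X.
Proof.
apply: wr1_inj; apply: (iso_mono (u := braid X 1)).
rewrite wrM -triangle; apply: esym.
rewrite compA braid_wl -lunit_assoc -!compA.
have := hexagon1 X 1 1; rewrite -!compA => ->.
by rewrite (tail2 (lunit_nat _)) -?compA (tail2 (lunit_assoc _ _)).
Qed.

Lemma braid_unitl X : r X ∘ c 1 X = l X.
Proof.
apply: wr1_inj; apply: (iso_epi (u := iso_sym (assoc 1 X 1))) => /=.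
rewrite -[in RHS]lunit_assoc -[in RHS]compA fwd_bwd compm1.
apply: (iso_epi (u := wl_iso 1 (braid 1 X))) => /=.
rewrite lunit_nat wrM -triangle -!compA.
have := hexagon2 1 1 X; rewrite -!compA => <-.
rewrite fbK (tail2 (esym (braid_wr _ _))) -?compA -lunit_assoc -?compA.
by rewrite fwd_bwd compm1.
Qed.

Definition cr X Y R := suf (c X Y) R.

Lemma cr_wr X X' Y R (f : mor X X') :
  cr X' Y R ∘ (f ▷ (Y ⊗ R)) = (Y ◁ (f ▷ R)) ∘ cr X Y R.
Proof. by rewrite -suf_wr -suf_wl -!sufM braid_wr. Qed.
Lemma cr_wl X Y Y' R (f : mor Y Y') :
  cr X Y' R ∘ (X ◁ (f ▷ R)) = (f ▷ (X ⊗ R)) ∘ cr X Y R.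
Proof. by rewrite -suf_wr -suf_wl -!sufM braid_wl. Qed.
Lemma crN X Y R R' (f : mor R R') :
  cr X Y R' ∘ (X ◁ (Y ◁ f)) = (Y ◁ (X ◁ f)) ∘ cr X Y R.
Proof. exact: sufN. Qed.

Lemma cr_unitr X R : l (X ⊗ R) ∘ cr X 1 R = X ◁ l R.
Proof.
rewrite /cr !sufE (tail2 (lunit_assoc _ _)) (tail2 (esym (wrM _ _ _))).
by rewrite braid_unitr -triangle -compA fwd_bwd compm1.
Qed.
Lemma cr_unitl X R : (X ◁ l R) ∘ cr 1 X R = l (X ⊗ R).
Proof.
rewrite /cr !sufE (tail2 (triangle _ _)) (tail2 (esym (wrM _ _ _))).
by rewrite braid_unitl -lunit_assoc -compA fwd_bwd compm1.
Qed.

(** A crossing with a tensor product is a pair of crossings. The hexagons say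
    so without a suffix; the pentagon supplies the suffix. *)
Lemma cr_hexr X Y Z R :
  a Y Z (X ⊗ R) ∘ cr X (Y ⊗ Z) R =
  (Y ◁ cr X Z R) ∘ (cr X Y (Z ⊗ R) ∘ (X ◁ a Y Z R)).
Proof.
apply: (iso_epi (u := assoc X (Y ⊗ Z) R)).
apply: (iso_epi (u := wr_iso R (assoc X Y Z))) => /=.
have := congr1 (fun f => f ▷ R) (hexagon1 X Y Z); rewrite !wrM -!compA => H.
rewrite /cr !sufE -?compA (bfK (assoc X (Y ⊗ Z) R)) (tail2 (pentagon' _ _ _ _)).
rewrite -?compA H !wlM -?compA -pentagon' bfK.
rewrite -aL (tail2 (pentagon' _ _ _ _)) -?compA.
rewrite (tail2 (wl_iso_bf Y (assoc X Z R))) comp1m.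
by rewrite (tail2 (aM _ _ _)) -?compA.
Qed.

Lemma cr_hexl X Y Z R :
  (Z ◁ a X Y R) ∘ cr (X ⊗ Y) Z R =
  cr X Z (Y ⊗ R) ∘ ((X ◁ cr Y Z R) ∘ a X Y (Z ⊗ R)).
Proof.
apply: (iso_epi (u := assoc (X ⊗ Y) Z R)).
apply: (iso_epi (u := wr_iso R (iso_sym (assoc X Y Z)))) => /=.
have := congr1 (fun f => f ▷ R) (hexagon2 X Y Z); rewrite !wrM -!compA => H.
rewrite /cr !sufE -?compA bfK !wlM -?compA pentagon_inv fbK.
rewrite (tail2 (wl_iso_bf X (assoc Y Z R))) comp1m -aM.
rewrite (tail3 (esym (pentagon_inv _ _ _ _))) -?compA (tail2 (esym (aL _ _ _))) -?compA -H.
rewrite (tail2 (pentagon' _ _ _ _)) -?compA.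
by rewrite (tail2 (wr_iso_fb R (assoc Z X Y))) comp1m.
Qed.

Section Slide.
Variables (A Y Z R : C).

(** A strand A passes freely across a cap: both crossings together are one
    crossing with the source of the cap, hence by naturality a crossing with
    the unit. *)
Lemma cr_capl (h : mor (Y ⊗ Z) 1) :
  cap h (A ⊗ R) ∘ ((Y ◁ cr A Z R) ∘ cr A Y (Z ⊗ R)) = A ◁ cap h R.
Proof.
apply: (iso_epi (u := wl_iso A (assoc Y Z R))) => /=.
rewrite -?compA -cr_hexr !capE -?compA bfK -cr_wl (tail2 (cr_unitr _ _)).
by rewrite -!wlM -?compA bwd_fwd compm1.
Qed.

Lemma cr_cupr (k : mor 1 (Y ⊗ Z)) :
  cr Y A (Z ⊗ R) ∘ ((Y ◁ cr Z A R) ∘ cup k (A ⊗ R)) = A ◁ cup k R.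
Proof.
rewrite !cupE !wlM (tail3 (esym (cr_hexl _ _ _ _))) -?compA; congr (_ ∘ _).
rewrite (tail2 (cr_wr _ _ _)) -?compA; congr (_ ∘ _).
apply: (iso_mono (u := wl_iso A (lunit R))) => /=.
by rewrite compA cr_unitl fwd_bwd (wl_iso_fb A (lunit R)).
Qed.

End Slide.

(** Naturality of the crossing of X with a product, applied to the braiding of
    Y and Z. *)
Lemma yang_baxter X Y Z R :
  (Z ◁ cr X Y R) ∘ (cr X Z (Y ⊗ R) ∘ (X ◁ cr Y Z R)) =
  cr Y Z (X ⊗ R) ∘ ((Y ◁ cr X Z R) ∘ cr X Y (Z ⊗ R)).
Proof.
apply: (iso_epi (u := wl_iso X (assoc Y Z R))) => /=.
rewrite -?compA -cr_hexr [cr Y Z R]/cr [cr Y Z _]/cr !sufE !wlM -?compA bfK.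
rewrite (wl_iso_bf X (assoc Y Z R)) compm1 (tail3 (esym (cr_hexr _ _ _ _))).
by rewrite -?compA cr_wl.
Qed.

End Braiding.

(** * Duals and mates *)

Section Mates.
Variables (K : fieldType) (C : tensor_category K).
Implicit Types X Y Z W R : C.
Local Notation a X Y Z := (fwd (assoc X Y Z)).
Local Notation a' X Y Z := (bwd (assoc X Y Z)).
Local Notation r' X := (bwd (runit X)).
Local Notation "1" := (tunit (t := C)).

(** Stated with every suffix, the form in which mates, and through them the
    cyclicity of traces, call for it. *)
Definition zigzag X X' (e : mor (X' ⊗ X) 1) (k : mor 1 (X ⊗ X')) :=
  forall R, (X ◁ cap e R) ∘ cup k (X ⊗ R) = idm (X ⊗ R).

(** The transpose of f with respect to arbitrary chosen duals of Y and Z. For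
    f the identity of Y it compares two duals of Y, so statements about mates
    include independence of the choice of dual. *)
Definition mate Y Y' Z Z' (k : mor 1 (Y ⊗ Y')) (e : mor (Z' ⊗ Z) 1)
    (f : mor Y Z) : mor Z' Y' :=
  cap e Y' ∘ ((Z' ◁ ((f ▷ Y') ∘ k)) ∘ r' Z').

Section Mate.
Variables (Y Y' Z Z' : C).
Variables (eY : mor (Y' ⊗ Y) 1) (kY : mor 1 (Y ⊗ Y')).
Variables (eZ : mor (Z' ⊗ Z) 1) (kZ : mor 1 (Z ⊗ Z')).
Variable f : mor Y Z.
Let m := mate kY eZ f.

Lemma mate_suf R :
  m ▷ R = cap eZ (Y' ⊗ R) ∘ (Z' ◁ ((f ▷ (Y' ⊗ R)) ∘ cup kY R)).
Proof.
rewrite /m /mate !wrM cap_tens -!compA -suf_wr -suf_cup.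
rewrite (tail2 (aM _ _ _)) -?compA triangle' !cupE !wlM -?compA.
by [].
Qed.

Lemma mate_ev : zigzag eY kY -> eY ∘ (m ▷ Y) = eZ ∘ (Z' ◁ f).
Proof.
move=> zY; apply: cap_inj => R; rewrite !suf_cap suf_wr suf_wl mate_suf.
rewrite compA -capN -compA -!wlM compA -exch -compA zY compm1.
by [].
Qed.

Lemma mate_cup R : zigzag eZ kZ ->
  (Z ◁ (m ▷ R)) ∘ cup kZ R = (f ▷ (Y' ⊗ R)) ∘ cup kY R.
Proof.
by move=> zZ; rewrite mate_suf wlM -compA -cupN compA zZ comp1m.
Qed.

End Mate.

End Mates.

Section RibbonDuals.
Variables (K : fieldType) (C : ribbon_fusion_category K).
Implicit Types X Y Z W R : C.
Local Notation a X Y Z := (fwd (assoc X Y Z)).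
Local Notation a' X Y Z := (bwd (assoc X Y Z)).
Local Notation c X Y := (fwd (braid X Y)).
Local Notation th X := (fwd (twist X)).
Local Notation "1" := (tunit (t := C)).

(** The right evaluation of the canonical spherical structure: the loop
    closing a strand is untwisted by the twist. *)
Definition evr X X' (e : mor (X' ⊗ X) 1) : mor (X ⊗ X') 1 :=
  locked ((e ∘ c X X') ∘ (th X ▷ X')).

Lemma evrE X X' (e : mor (X' ⊗ X) 1) : evr e = (e ∘ c X X') ∘ (th X ▷ X').
Proof. by rewrite /evr -lock. Qed.

Lemma cap_evr X X' (e : mor (X' ⊗ X) 1) R :
  cap (evr e) R = cap (e ∘ c X X') R ∘ (th X ▷ (X' ⊗ R)).
Proof. by rewrite evrE suf_cap suf_wr. Qed.

(** The right evaluation is dinatural because the left one is, and braiding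
    and twist are natural. *)
Lemma evr_mate Y Y' Z Z' (eY : mor (Y' ⊗ Y) 1) (kY : mor 1 (Y ⊗ Y'))
    (eZ : mor (Z' ⊗ Z) 1) (f : mor Y Z) :
  zigzag eY kY -> evr eZ ∘ (f ▷ Z') = evr eY ∘ (Y ◁ mate kY eZ f).
Proof.
move=> zY; rewrite !evrE -!compA exch (tail2 (braid_wl _ _)) -?compA.
rewrite (tail2 (mate_ev eZ f zY)) -?compA -!wrM twist_nat !wrM.
by rewrite (tail2 (braid_wr _ _)) -?compA.
Qed.

Section Flip.
Variables (X X' : C) (e : mor (X' ⊗ X) 1) (k : mor 1 (X ⊗ X')).

(** X is a left dual of its left dual X': evaluate with a crossing and
    coevaluate with an inverse crossing of the opposite sign. Sliding the free
    strand across the cap and applying the Yang-Baxter relation cancels the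
    inverse crossing, and a second slide leaves the other zigzag of e and k. *)
Lemma zigzag_flip : (forall R, cap e (X' ⊗ R) ∘ (X' ◁ cup k R) = idm (X' ⊗ R)) ->
  zigzag (e ∘ c X X') (bwd (braid X' X) ∘ k).
Proof.
move=> z R; rewrite suf_cap suf_cup wlM -cr_capl -/(cr _ _ _) -?compA.
rewrite (tail3 (yang_baxter _ _ _ _)) -?compA /(cr X' X) (tail2 (esym (sufM _ _ _))).
by rewrite fwd_bwd suf1 comp1m cr_cupr.
Qed.

End Flip.

Section Composite.
Variables (Y Y' Z Z' : C).
Variables (eY : mor (Y' ⊗ Y) 1) (kY : mor 1 (Y ⊗ Y')).
Variables (eZ : mor (Z' ⊗ Z) 1) (kZ : mor 1 (Z ⊗ Z')).

(** Nested evaluations make Z' tensor Y' a dual of Y tensor Z. *)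
Definition ev2 : mor ((Z' ⊗ Y') ⊗ (Y ⊗ Z)) 1 :=
  eZ ∘ ((Z' ◁ cap eY Z) ∘ a Z' Y' (Y ⊗ Z)).
Definition coev2 : mor 1 ((Y ⊗ Z) ⊗ (Z' ⊗ Y')) :=
  a' Y Z (Z' ⊗ Y') ∘ ((Y ◁ cup kZ Y') ∘ kY).

Lemma cup_coev2 R :
  (Y ◁ (Z ◁ a Z' Y' R)) ∘ (a Y Z ((Z' ⊗ Y') ⊗ R) ∘ cup coev2 R) =
  (Y ◁ cup kZ (Y' ⊗ R)) ∘ cup kY R.
Proof.
rewrite [cup coev2 R]cupE /coev2 !wrM -!compA (tail2 (pentagon_inv _ _ _ _)).
rewrite -?compA fbK (tail2 (aM _ _ _)) -?compA.
by rewrite -(cup_tens kZ) [cup kY R]cupE !wlM -?compA.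
Qed.

Lemma cap_ev2 R :
  cap ev2 R = cap eZ R ∘ ((Z' ◁ cap eY (Z ⊗ R)) ∘
    ((Z' ◁ (Y' ◁ a Y Z R)) ∘ a Z' Y' ((Y ⊗ Z) ⊗ R))).
Proof.
apply: (iso_epi (u := assoc (Z' ⊗ Y') (Y ⊗ Z) R)).
rewrite [cap ev2 R]capE /ev2 !wrM -!compA bwd_fwd compm1 pentagon'.
rewrite [cap eZ R]capE -?compA.
have := congr1 (fun f => Z' ◁ f) (cap_tens eY Z R); rewrite !wlM => H.
by rewrite (tail3 (esym H)) (tail2 (a'M _ _ _)) -?compA bfK.
Qed.

Lemma zigzag_ev2 : zigzag eY kY -> zigzag eZ kZ -> zigzag ev2 coev2.
Proof.
move=> zY zZ R; apply: (iso_mono (u := assoc Y Z R)); rewrite compm1.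
rewrite compA aR cap_ev2 !wlM -?compA cup_coev2.
rewrite (tail2 (esym (wlM _ _ (cup kZ _)))) -cupN wlM -?compA -cupN.
rewrite (tail2 (esym (wlM _ _ (cup kZ _)))) -cupN wlM -?compA.
rewrite (tail2 (esym (wlM _ _ (cup kZ _)))) zZ tensm1 comp1m.
by rewrite compA zY comp1m.
Qed.

Lemma suf_twist_tens R :
  suf (th (Y ⊗ Z)) R =
  cr Z Y R ∘ (cr Y Z R ∘ ((th Y ▷ (Z ⊗ R)) ∘ (Y ◁ (th Z ▷ R)))).
Proof. by rewrite twist_tens [th Y ⊠ th Z]tensE !sufM suf_wr suf_wl -?compA. Qed.

(** The isotopy behind evr_ev2: the curl made by two parallel strands Y and Z,
    once twists are removed, opens into nested curls. The Yang-Baxter relation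
    moves the crossing of the strands past the inner cap, the inner cap is
    pulled across Z, and then the outer one across Y. *)
Lemma nested_caps R :
  cap eZ R ∘ ((Z' ◁ cap (eY ∘ c Y Y') (Z ⊗ R)) ∘ ((Z' ◁ (Y ◁ cr Z Y' R)) ∘
    (cr Y Z' (Z ⊗ (Y' ⊗ R)) ∘ ((Y ◁ cr Z Z' (Y' ⊗ R)) ∘
      (cr Z Y (Z' ⊗ (Y' ⊗ R)) ∘ cr Y Z (Z' ⊗ (Y' ⊗ R))))))) =
  cap (eY ∘ c Y Y') R ∘ (Y ◁ cap (eZ ∘ c Z Z') (Y' ⊗ R)).
Proof.
rewrite (tail3 (esym (yang_baxter Z Y Z' (Y' ⊗ R)))) -?compA.
have := congr1 (fun f => Z' ◁ f) (cr_capl Z R (eY ∘ c Y Y')).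
rewrite !wlM => H; rewrite (tail3 H) (tail2 (capN _ _)) -?compA; congr (_ ∘ _).
rewrite (tail2 (esym (suf_cap _ _ _))).
exact: cr_capl.
Qed.

(** Right evaluations nest as well. The twist of a tensor product contributes
    exactly the double braiding that nested_caps absorbs; without the twist in
    evr the statement would fail. *)
Lemma evr_ev2 R :
  cap (evr ev2) R = cap (evr eY) R ∘ ((Y ◁ cap (evr eZ) (Y' ⊗ R)) ∘
    ((Y ◁ (Z ◁ a Z' Y' R)) ∘ a Y Z ((Z' ⊗ Y') ⊗ R))).
Proof.
rewrite !cap_evr [cap (ev2 ∘ _) _]suf_cap -/(cr _ _ _) cap_ev2.
rewrite -?compA (tail2 (cr_hexr _ _ _ _)) -?compA.
have := congr1 (fun f => Z' ◁ f) (cr_hexl Y Z Y' R); rewrite !wlM => H.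
rewrite (tail2 H) -?compA (tail2 (cr_hexl _ _ _ _)) -?compA -exch.
rewrite (tail2 (esym (suf_assoc _ _))) -?compA aR suf_twist_tens -?compA.
rewrite (tail2 (esym (wlM _ (cap eY _) _))) -suf_cap.
have := congr1 (fun f => f ∘ ((th Y ▷ (Z ⊗ (Z' ⊗ (Y' ⊗ R)))) ∘
  ((Y ◁ (th Z ▷ (Z' ⊗ (Y' ⊗ R)))) ∘
  ((Y ◁ (Z ◁ a Z' Y' R)) ∘ a Y Z ((Z' ⊗ Y') ⊗ R))))) (nested_caps R).
rewrite -?compA => ->.
by rewrite (tail2 (exch (th Y) (cap _ _))) -?compA.
Qed.

End Composite.
End RibbonDuals.

(** * Traces and partial traces of the double braiding *)

Section Traces.
Variables (K : fieldType) (C : ribbon_fusion_category K).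
Implicit Types X Y Z W R Q S : C.
Local Notation a X Y Z := (fwd (assoc X Y Z)).
Local Notation a' X Y Z := (bwd (assoc X Y Z)).
Local Notation l X := (fwd (lunit X)).
Local Notation l' X := (bwd (lunit X)).
Local Notation c X Y := (fwd (braid X Y)).
Local Notation th X := (fwd (twist X)).
Local Notation "1" := (tunit (t := C)).

(** A left dual X' of X is a parameter, so that the trace of a tensor product
    can be computed with nested duals. The value is an endomorphism of the
    unit. *)
Definition trace X X' (e : mor (X' ⊗ X) 1) (k : mor 1 (X ⊗ X')) (f : mor X X) :
    mor 1 1 :=
  evr e ∘ ((f ▷ X') ∘ k).

(** Locked, like cap and cup, because it is itself a composite. *)
Definition double_braid W Y S : mor (W ⊗ (Y ⊗ S)) (W ⊗ (Y ⊗ S)) :=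
  locked (cr Y W S ∘ cr W Y S).

(** The partial trace over Y of the double braiding of W and Y, that is a
    strand W linked by a loop Y. An endomorphism of Y sitting on the loop is
    absorbed into the closing evaluation h. *)
Definition encircle W Y Y' (h : mor (Y ⊗ Y') 1) (k : mor 1 (Y ⊗ Y')) R :
    mor (W ⊗ R) (W ⊗ R) :=
  locked ((W ◁ cap h R) ∘ (double_braid W Y (Y' ⊗ R) ∘ (W ◁ cup k R))).

Lemma double_braidE W Y S : double_braid W Y S = cr Y W S ∘ cr W Y S.
Proof. by rewrite /double_braid -lock. Qed.
Lemma encircleE W Y Y' (h : mor (Y ⊗ Y') 1) (k : mor 1 (Y ⊗ Y')) R :
  encircle W h k R = (W ◁ cap h R) ∘ (double_braid W Y (Y' ⊗ R) ∘ (W ◁ cup k R)).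
Proof. by rewrite /encircle -lock. Qed.

Lemma cap_cup Y Y' (h : mor (Y ⊗ Y') 1) (k : mor 1 (Y ⊗ Y')) R :
  cap h R ∘ cup k R = l R ∘ (((h ∘ k) ▷ R) ∘ l' R).
Proof. by rewrite capE cupE wrM -!compA bfK. Qed.

Lemma double_braid_suf W Y S : double_braid W Y S = suf (c Y W ∘ c W Y) S.
Proof. by rewrite !double_braidE /cr -sufM. Qed.

Lemma double_braid_wl W Y Z S (f : mor Y Z) :
  double_braid W Z S ∘ (W ◁ (f ▷ S)) = (W ◁ (f ▷ S)) ∘ double_braid W Y S.
Proof. by rewrite !double_braidE -compA cr_wl compA cr_wr -compA. Qed.

Lemma double_braidN W Y S S' (f : mor S S') :
  double_braid W Y S' ∘ (W ◁ (Y ◁ f)) = (W ◁ (Y ◁ f)) ∘ double_braid W Y S.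
Proof. by rewrite !double_braid_suf sufN. Qed.

Section Cyclic.
Variables (Y Y' Z Z' : C).
Variables (eY : mor (Y' ⊗ Y) 1) (kY : mor 1 (Y ⊗ Y')).
Variables (eZ : mor (Z' ⊗ Z) 1) (kZ : mor 1 (Z ⊗ Z')).
Hypotheses (zY : zigzag eY kY) (zZ : zigzag eZ kZ).
Variables (f : mor Y Z) (g : mor Z Y).
Let mf := mate kY eZ f.
Let mg := mate kZ eY g.

Lemma evr_comp : evr eY ∘ ((g ∘ f) ▷ Y') = evr eZ ∘ ((Z ◁ mg) ∘ (f ▷ Y')).
Proof. by rewrite wrM compA (evr_mate eY g zZ) -compA. Qed.

(** Both composites g f and f g are brought to a form in which f and g have
    become mates on the dual side; comparing these forms is what makes traces
    cyclic. *)
Lemma evr_comp_mates : evr eZ ∘ ((f ∘ g) ▷ Z') = evr eZ ∘ ((Z ◁ mg) ∘ (Z ◁ mf)).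
Proof.
rewrite wrM compA (evr_mate eZ f zY) -compA -exch compA (evr_mate eY g zZ).
by rewrite -compA.
Qed.

Lemma mate_coev : (f ▷ Y') ∘ kY = (Z ◁ mf) ∘ kZ.
Proof.
by apply: cup_inj => R; rewrite !suf_cup suf_wr suf_wl /mf mate_cup.
Qed.

Lemma trace_cyclic : trace eY kY (g ∘ f) = trace eZ kZ (f ∘ g).
Proof.
rewrite /trace !compA evr_comp evr_comp_mates -!compA mate_coev.
by [].
Qed.

(** An endomorphism slides along the loop, through both crossings by
    naturality. With f and g identities, the loop may be formed with any dual.
    *)
Lemma encircle_cyclic W R :
  encircle W (evr eY ∘ ((g ∘ f) ▷ Y')) kY R = encircle W (evr eZ ∘ ((f ∘ g) ▷ Z')) kZ R.
Proof.
rewrite !encircleE evr_comp evr_comp_mates !suf_cap !sufM !suf_wl !suf_wr !wlM -!compA.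
congr (_ ∘ (_ ∘ _)); rewrite (tail2 (esym (double_braid_wl _ _ _))) -compA -wlM.
by rewrite -(mate_cup _ _ _ zZ) wlM (tail2 (double_braidN _ _ _)) -compA.
Qed.

End Cyclic.

Section EncircleNaturality.
Variables (W Y Y' : C) (h : mor (Y ⊗ Y') 1) (k : mor 1 (Y ⊗ Y')).

Lemma encircleN R R' (f : mor R R') :
  encircle W h k R' ∘ (W ◁ f) = (W ◁ f) ∘ encircle W h k R.
Proof.
rewrite !encircleE -!compA -wlM cupN wlM (tail2 (double_braidN _ _ _)) -?compA.
by rewrite !(tail2 (esym (wlM _ _ _))) capN.
Qed.

(** The suffix is not touched by the loop. This is why the scalar in
    encircle_scalar is the same for all R. *)
Lemma encircle_tens R Q :
  a W R Q ∘ (encircle W h k R ▷ Q) = encircle W h k (R ⊗ Q) ∘ a W R Q.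
Proof.
rewrite !encircleE !wrM -!compA (tail2 (aM _ _ _)) cap_tens !wlM -?compA.
rewrite !double_braid_suf (tail3 (suf_tens _ _ _)) -?compA (tail2 (esym (sufN _ _))) -?compA.
by rewrite aM -(cup_tens k) !wlM -?compA.
Qed.

(** A loop around a strand with scalar endomorphisms acts by a scalar: this is
    the definition at R = 1, and any other suffix is reached from 1 tensor R
    by naturality. *)
Lemma encircle_scalar : (forall f : mor W W, exists x, f = x *: idm W) ->
  exists x, forall R, encircle W h k R = x *: idm (W ⊗ R).
Proof.
move=> W1; pose u := runit W.
have [x Ex] := W1 (fwd u ∘ (encircle W h k 1 ∘ bwd u)); exists x => R.
have E1 : encircle W h k 1 = x *: idm (W ⊗ 1).
  rewrite -[LHS](bfK u) -[encircle W h k 1]compm1 -(bwd_fwd u).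
  by rewrite (tail3 Ex) compmZl comp1m compmZr.
have E2 : encircle W h k (1 ⊗ R) = x *: idm (W ⊗ (1 ⊗ R)).
  apply: (iso_epi (u := assoc W 1 R)).
  by rewrite -encircle_tens E1 tensmZl tensm1 compmZr compmZl compm1 comp1m.
apply: (iso_epi (u := wl_iso W (lunit R))) => /=.
by rewrite encircleN E2 compmZr compmZl compm1 comp1m.
Qed.

End EncircleNaturality.

Section Composite.
Variables (Y Y' Z Z' : C).
Variables (eY : mor (Y' ⊗ Y) 1) (kY : mor 1 (Y ⊗ Y')).
Variables (eZ : mor (Z' ⊗ Z) 1) (kZ : mor 1 (Z ⊗ Z')).
Let e := ev2 eY eZ.
Let k := coev2 kY kZ.

Lemma double_braid_tens W S :
  (W ◁ a Y Z S) ∘ double_braid W (Y ⊗ Z) S =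
  cr Y W (Z ⊗ S) ∘ ((Y ◁ double_braid W Z S) ∘ (cr W Y (Z ⊗ S) ∘ (W ◁ a Y Z S))).
Proof.
by rewrite !double_braidE (tail2 (cr_hexl _ _ _ _)) -?compA cr_hexr !wlM -?compA.
Qed.

(** A loop coloured by a tensor product is a pair of nested loops. By
    hypothesis the inner one is a scalar and is removed. *)
Lemma encircle_ev2 W x :
  (forall R, encircle W (evr eZ) kZ R = x *: idm (W ⊗ R)) ->
  forall R, encircle W (evr e) k R = x *: encircle W (evr eY) kY R.
Proof.
move=> Ex R; rewrite !encircleE /e /k evr_ev2 !wlM -?compA.
rewrite (tail2 (double_braid_tens _ _)) -?compA.
rewrite !(tail2 (esym (crN _ _ _))) -?compA.
rewrite (tail2 (esym (wlM _ (W ◁ (Z ◁ _)) (double_braid _ _ _)))) -double_braidN wlM -?compA.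
rewrite !(tail2 (esym (crN _ _ _))) -?compA -!(wlM W) cup_coev2 wlM.
rewrite (tail2 (crN _ _ (cup kZ _))) -?compA.
rewrite (tail2 (esym (wlM _ (double_braid _ _ _) _))) (tail2 (esym (wlM Y _ _))) -encircleE Ex.
by rewrite tensmZr tensm1 compmZl comp1m double_braidE -?compA !compmZr.
Qed.

(** The trace of the double braiding on a tensor product closes first the
    strand Z, leaving Y linked by a loop Z, and then Y. *)
Lemma trace_ev2 x :
  (forall R, encircle Y (evr eZ) kZ R = x *: idm (Y ⊗ R)) ->
  trace e k (c Z Y ∘ c Y Z) = x *: trace eY kY (idm Y).
Proof.
move=> Ex; apply: wr1_inj; apply: (iso_mono (u := lunit 1)).
apply: (iso_epi (u := iso_sym (lunit 1))) => /=.
rewrite /trace -!compA tensmZl compmZl compmZr -!cap_cup tensm1 comp1m /e /k.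
rewrite suf_cup suf_wr evr_ev2 -?compA (tail2 (esym (suf_assoc _ _))) -?compA.
rewrite -double_braid_suf (tail2 (esym (double_braidN _ _ _))) -?compA cup_coev2.
rewrite (tail3 (esym (encircleE _ _ _ _))) Ex.
by rewrite compmZl comp1m compmZr.
Qed.

End Composite.
End Traces.

(** * Linear algebra of morphism spaces *)

Section VectLemmas.
Variable F : fieldType.

(** A family with dual coordinate functions that span is a basis; indexing by
    a predicate on a finite type avoids subtypes. *)
Lemma dim_of_coords (V : vectType F) (A : finType) (P : pred A)
    (c : A -> {scalar V}) (v : A -> V) :
  (forall a b, P a -> P b -> c a (v b) = (a == b)%:R) ->
  (forall f, f = \sum_(a | P a) c a f *: v a) -> \dim {:V} = #|P|.
Proof.
move=> cv fE; pose X := [tuple v (enum_val i) | i < #|P|].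
have nthX (i : 'I_#|P|) : X`_i = v (enum_val i).
  by rewrite -tnth_nth tnth_mktuple.
have PX (i : 'I_#|P|) : P (enum_val i) := enum_valP i.
apply: (@size_basis _ _ fullv _ X); rewrite /basis_of; apply/andP; split.
  rewrite eqEsubv subvf; apply/subvP => f _; rewrite [f]fE.
  apply: rpred_sum => a Pa; apply/rpredZ/memv_span.
  by rewrite -(enum_rankK_in Pa Pa) -nthX mem_nth // size_tuple.
apply/freeP => k E i; have /(congr1 (c (enum_val i))) := E.
rewrite linear_sum linear0 (bigD1 i) //= linearZ /= nthX cv // eqxx mulr1.
rewrite big1 ?addr0 // => j ji; rewrite linearZ /= nthX cv // (inj_eq enum_val_inj).
by rewrite eq_sym (negPf ji) mulr0.
Qed.

Lemma dim_inj (V W : vectType F) (f : {linear V -> W}) :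
  injective f -> (\dim {:V} <= \dim {:W})%N.
Proof.
move=> fI; have k0 : lker (linfun f) == 0%VS.
  by apply/lker0P => u v; rewrite !lfunE; apply: fI.
rewrite -(limg_dim_eq (f := linfun f)) ?dimvS ?subvf //.
by rewrite (eqP k0) capv0.
Qed.

End VectLemmas.

Section Determinant.
Variables (F : closedFieldType) (V : vectType F).
Implicit Type L : 'End(V).
Let e := vbasis {:V}.
Let eb : basis_of {:V} e := vbasisP {:V}.

Definition lfdet L : F := \det (mxof e e L).

Lemma lfdet_comp L M : lfdet (L \o M)%VF = lfdet L * lfdet M.
Proof. by rewrite /lfdet (mxof_comp _ _ eb) det_mulmx mulrC. Qed.

Lemma lfdetZ1 a : lfdet (a *: \1)%VF = a ^+ \dim {:V}.
Proof. by rewrite /lfdet linearZ /= mxof1 ?(basis_free eb) // scalemx1 det_scalar. Qed.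

Lemma char_root_eigen L a : root (char_poly (mxof e e L)) a ->
  exists2 v, v != 0 & L v = a *: v.
Proof.
rewrite -eigenvalue_root_char => /eigenvalueP[u Eu u0].
exists (vecof e u); first by rewrite (vecof_eq0 eb).
by rewrite (hom_vecof _ eb) Eu linearZ.
Qed.

Lemma exists_eigenvector L : (exists v : V, v != 0) ->
  exists a, exists2 v, v != 0 & L v = a *: v.
Proof.
case=> v v0; have /closed_rootP[a] : size (char_poly (mxof e e L)) != 1%N.
  rewrite size_char_poly eqSS dimv_eq0; apply: contra v0 => /eqP E.
  by rewrite -memv0 -E memvf.
by move=> /char_root_eigen; exists a.
Qed.

Lemma lfdet_eigen L : exists2 s : seq F, size s = \dim {:V} &
  lfdet L = \prod_(a <- s) a /\
  forall a, a \in s -> exists2 v, v != 0 & L v = a *: v.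
Proof.
pose p := char_poly (mxof e e L).
have [s Ep] := closed_field_poly_normal p.
have p1 : lead_coef p = 1 by apply/eqP/char_poly_monic.
rewrite p1 scale1r in Ep; exists s.
  by apply: succn_inj; rewrite -(size_prod_XsubC s id) -Ep size_char_poly.
split=> [|a sa]; last first.
  by apply: char_root_eigen; rewrite -/p Ep root_prod_XsubC.
have sz : size s = \dim {:V}.
  by apply: succn_inj; rewrite -(size_prod_XsubC s id) -Ep size_char_poly.
have Es : \prod_(a <- s) ('X - a%:P).[0] = (-1) ^+ size s * \prod_(a <- s) a.
  elim: (s) => [|a t IH]; first by rewrite !big_nil mulr1.
  by rewrite !big_cons IH hornerXsubC sub0r /= exprS; ring.
have := char_poly_det (mxof e e L); rewrite -/p -horner_coef0 Ep horner_prod Es sz.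
by move/(mulrI (unitrX _ (unitrN1 _))) => /esym.
Qed.

End Determinant.

(** * Simple objects and multiplicities *)

Section Composition.
Variables (K : fieldType) (C : linear_category K).
Implicit Types X Y Z : C.

Definition postcomp X Y Z (g : mor Y Z) (f : mor X Y) : mor X Z := g ∘ f.
Definition precomp X Y Z (f : mor X Y) (g : mor Y Z) : mor X Z := g ∘ f.

Lemma postcomp_linear X Y Z (g : mor Y Z) : linear (@postcomp X Y Z g).
Proof. exact: comp_linear_r. Qed.
Lemma precomp_linear X Y Z (f : mor X Y) : linear (@precomp X Y Z f).
Proof. exact: comp_linear_l. Qed.

HB.instance Definition _ X Y Z (g : mor Y Z) :=
  GRing.isLinear.Build K (mor X Y) (mor X Z) *:%R (postcomp g)
    (postcomp_linear g).
HB.instance Definition _ X Y Z (f : mor X Y) :=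
  GRing.isLinear.Build K (mor Y Z) (mor X Z) *:%R (precomp f)
    (precomp_linear f).

Lemma scalar_of_linear X : scalar (@scalar_of K C X).
Proof. by move=> a f g; rewrite /scalar_of linearP. Qed.
HB.instance Definition _ X :=
  GRing.isLinear.Build K (mor X X) K *%R (@scalar_of K C X)
    (@scalar_of_linear X).

Lemma scalar_ofZ1 X a : idm X <> 0 -> scalar_of (a *: idm X) = a.
Proof.
move=> /eqP X0; have fX : free [tuple idm X] by move: X0; rewrite -seq1_free.
by rewrite linearZ /= /scalar_of (coord_free ord0 ord0 fX) mulr1.
Qed.

Lemma dim_iso_l X Y Z (u : iso X Y) :
  \dim {: mor X Z} = \dim {: mor Y Z}.
Proof.
apply/eqP; rewrite eqn_leq; apply/andP; split.
  apply: (dim_inj (f := precomp (bwd u))) => f g; exact: (iso_epi (u := iso_sym u)).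
apply: (dim_inj (f := precomp (fwd u))) => f g; exact: (iso_epi (u := u)).
Qed.

Lemma is_iso_iso X Y (f : mor X Y) : is_iso f -> isomorphic X Y.
Proof. by case=> g [gf fg]; split; apply: Iso gf fg. Qed.

Section Schur.
Hypothesis Cab : abelian_cat C.

(** The kernel of f is a subobject of X, so it is X, and f = 0, or it is 0,
    and f is a monomorphism into the simple object Y. *)
Lemma schur X Y (f : mor X Y) : simple_obj X -> simple_obj Y ->
  f = 0 \/ is_iso f.
Proof.
case=> [X0 sX] [Y0 sY]; case: Cab => _ kerC _ _ _.
have [Z [k [fk kU]]] := kerC _ _ f.
have km : mono k.
  move=> W g h kgh; have [|u [_ uU]] := kU W (k ∘ g).
    by rewrite compA fk comp0m.
  by rewrite -(uU g) // -(uU h).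
case: (sX Z k km) => [k0|[k' [_ kk']]]; last first.
  by left; rewrite -[f]compm1 -kk' compA fk comp0m.
case: (sY X f) => [W g h fgh|->|]; [|by left|by right].
have /kU[u [ku _]] : f ∘ (g - h) = 0.
  by rewrite compmDr -scaleN1r compmZr fgh scaleN1r subrr.
by apply/eqP; rewrite -subr_eq0 -ku k0 comp0m.
Qed.

End Schur.
End Composition.

(** Composition with f has an eigenvector g, of eigenvalue a; f - a kills g,
    so it is not invertible and vanishes. *)
Lemma schur_scalar (K : closedFieldType) (C : linear_category K) (X : C)
    (f : mor X X) :
  abelian_cat C -> simple_obj X -> exists a, f = a *: idm X.
Proof.
move=> Cab sX; have [X0 _] := sX.
have [|a [v v0 fv]] := @exists_eigenvector K (mor X X) (linfun (postcomp f)).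
  by exists (idm X); apply/eqP.
exists a; have [E|[g [gf _]]] := schur Cab (f - a *: idm X) sX sX.
  by apply/eqP; rewrite -subr_eq0 E.
case/eqP: v0; rewrite -[v]comp1m -gf -compA.
have -> : (f - a *: idm X) ∘ v = 0; last exact: compm0.
rewrite compmDl -scaleNr compmZl comp1m; move: fv; rewrite lfunE /= /postcomp => ->.
by rewrite -scalerDl subrr scale0r.
Qed.


Section Multiplicities.
Variables (K : closedFieldType) (C : ribbon_fusion_category K).
Variables (n : nat) (X : simple_reps C n).
Local Notation I := 'I_n.+1.
Implicit Types (i j k : I) (Y Z : C).

Definition mult k Y : nat := \dim {: mor (X k) Y}.

Lemma fusion_abelian : abelian_cat C.
Proof. by case: (fusion_semisimple C). Qed.

Lemma rep_neq0 i : idm (X i) <> 0.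
Proof. by case: (rep_simple X i). Qed.

Lemma rep_scalar i (f : mor (X i) (X i)) : exists a, f = a *: idm (X i).
Proof. exact: schur_scalar fusion_abelian (rep_simple X i). Qed.

Lemma scalar_ofE i (f : mor (X i) (X i)) : f = scalar_of f *: idm (X i).
Proof.
by have [a ->] := rep_scalar f; rewrite scalar_ofZ1 //; apply: rep_neq0.
Qed.

Lemma scalar_of1 i : scalar_of (idm (X i)) = 1.
Proof. by rewrite -[idm _]scale1r scalar_ofZ1 //; apply: rep_neq0. Qed.

Lemma rep_hom0 i j (f : mor (X i) (X j)) : i != j -> f = 0.
Proof.
move=> ij.
have [//|/is_iso_iso/rep_inj E] :=
  schur fusion_abelian f (rep_simple X i) (rep_simple X j).
by rewrite E eqxx in ij.
Qed.

(** Identity on the diagonal and zero elsewhere, so that families of morphisms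
    between the X i can be compared without transport along i = j. *)
Definition delta_mor i j : mor (X i) (X j) :=
  match i =P j with
  | ReflectT e => ecast x (mor (X i) (X x)) e (idm (X i))
  | ReflectF _ => 0
  end.

Lemma delta_mor1 i : delta_mor i i = idm (X i).
Proof.
by rewrite /delta_mor; case: eqP => // e; rewrite (eq_irrelevance e erefl).
Qed.

(** The coefficient of f on delta_mor i j; by Schur's lemma it is a coordinate
    on a space of dimension 1 or 0. *)
Definition delta_coef i j (f : mor (X i) (X j)) : K :=
  scalar_of (postcomp (delta_mor j i) f).

Lemma delta_coef_linear i j : scalar (@delta_coef i j).
Proof. by move=> a f g; rewrite /delta_coef !linearP. Qed.
HB.instance Definition _ i j :=
  GRing.isLinear.Build K (mor (X i) (X j)) K *%R (@delta_coef i j)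
    (@delta_coef_linear i j).

Lemma delta_coefE i j (f : mor (X i) (X j)) : f = delta_coef f *: delta_mor i j.
Proof.
have [ij|ij] := eqVneq i j; last by rewrite (rep_hom0 f ij) linear0 scale0r.
subst j; rewrite /delta_coef delta_mor1 /postcomp comp1m.
exact: scalar_ofE.
Qed.

Lemma delta_coef_delta i j : delta_coef (delta_mor i j) = (i == j)%:R.
Proof.
have [ij|ij] := eqVneq i j; last by rewrite (rep_hom0 (delta_mor i j) ij) linear0.
by subst j; rewrite /delta_coef delta_mor1 /postcomp comp1m scalar_of1.
Qed.

(** Semisimplicity gives simple summands; transporting them along isomorphisms
    replaces each by a representative X (x b). *)
Lemma decomposition Y : exists m (x : 'I_m -> I)
    (inc : forall a, mor (X (x a)) Y) (prj : forall a, mor Y (X (x a))),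
  [/\ forall a, prj a ∘ inc a = idm (X (x a)),
      forall a b, a != b -> prj b ∘ inc a = 0
    & \sum_a inc a ∘ prj a = idm Y].
Proof.
have [_ /(_ Y)[m [F [sF [inc [prj [pi p0 s1]]]]]]] := fusion_semisimple C.
have /fin_all_exists[x xP] a : exists i, isomorphic (F a) (X i).
  exact: rep_full.
have /fin_all_exists[u _] a : exists u : iso (F a) (X (x a)), True.
  by case: (xP a) => u; exists u.
exists m, x, (fun a => inc a ∘ bwd (u a)), (fun a => fwd (u a) ∘ prj a); split.
- by move=> a; rewrite -compA (tail2 (pi a)) comp1m fwd_bwd.
- by move=> a b ab; rewrite -compA (tail2 (p0 a b ab)) comp0m compm0.
- rewrite -s1; apply: eq_bigr => a _.
  by rewrite -compA bfK.
Qed.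

Section Count.
Variables (Y : C) (m : nat) (x : 'I_m -> I).
Variables (inc : forall a, mor (X (x a)) Y) (prj : forall a, mor Y (X (x a))).
Hypotheses (prj_inc : forall a, prj a ∘ inc a = idm (X (x a)))
  (prj_inc0 : forall a b, a != b -> prj b ∘ inc a = 0)
  (inc_prj : \sum_a inc a ∘ prj a = idm Y).

(** The components of a decomposition isomorphic to X k, composed with
    inclusions, form a basis. *)
Lemma mult_count k : mult k Y = #|[pred a | x a == k]|.
Proof.
pose c a : {scalar mor (X k) Y} := (@delta_coef k (x a) \o postcomp (prj a)).
pose v a := inc a ∘ delta_mor k (x a).
apply: (dim_of_coords (c := c) (v := v)) => [a b /eqP xa xb|f].
  rewrite /c /v /= /postcomp; have [<-|ab] := eqVneq a b.
    by rewrite compA prj_inc comp1m delta_coef_delta xa eqxx.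
  by rewrite compA prj_inc0 1?eq_sym // comp0m linear0.
rewrite -[LHS]comp1m -inc_prj compm_suml (bigID [pred a | x a == k]) /=.
rewrite [X in _ + X]big1 ?addr0 => [|a xa]; last first.
  by rewrite -compA (rep_hom0 (prj a ∘ f)) ?compm0 // eq_sym.
apply: eq_bigr => a _; rewrite -compA [prj a ∘ f]delta_coefE compmZr.
by [].
Qed.

Lemma mult_count_dual k : \dim {: mor Y (X k)} = #|[pred a | x a == k]|.
Proof.
pose c a : {scalar mor Y (X k)} := (@delta_coef (x a) k \o precomp (inc a)).
pose v a := delta_mor (x a) k ∘ prj a.
apply: (dim_of_coords (c := c) (v := v)) => [a b /eqP xa xb|f].
  rewrite /c /v /= /precomp; have [<-|ab] := eqVneq a b.
    by rewrite -compA prj_inc compm1 delta_coef_delta xa eqxx.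
  by rewrite -compA prj_inc0 // compm0 linear0.
rewrite -[LHS]compm1 -inc_prj compm_sumr (bigID [pred a | x a == k]) /=.
rewrite [X in _ + X]big1 ?addr0 => [|a xa]; last first.
  by rewrite compA (rep_hom0 (f ∘ inc a)) ?comp0m.
apply: eq_bigr => a _; rewrite compA [f ∘ inc a]delta_coefE compmZl.
by [].
Qed.

Lemma sum_mult (g : I -> K) : \sum_a g (x a) = \sum_k (mult k Y)%:R * g k.
Proof.
rewrite (partition_big x xpredT) //=; apply: eq_bigr => k _.
rewrite (eq_bigr (fun=> g k)) => [|a /eqP -> //].
by rewrite sumr_const mult_count mulr_natl.
Qed.

End Count.

Lemma mult_dual k Y : \dim {: mor Y (X k)} = mult k Y.
Proof.
have [m [x [inc [prj [h1 h2 h3]]]]] := decomposition Y.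
by rewrite (mult_count h1 h2 h3) (mult_count_dual h1 h2 h3).
Qed.

(** Insert a decomposition of Y and move each inclusion around the cycle.  It
    serves for the trace of the twist and for the additivity of fusion_char. *)
Lemma additive_functional (psi : forall Y, {scalar mor Y Y})
    (zeta : forall Y, mor Y Y) (z : I -> K) Y :
  (forall Y Z (f : mor Y Z) (g : mor Z Y), psi Y (g ∘ f) = psi Z (f ∘ g)) ->
  (forall Y Z (f : mor Y Z), zeta Z ∘ f = f ∘ zeta Y) ->
  (forall k, zeta (X k) = z k *: idm (X k)) ->
  psi Y (zeta Y) = \sum_k (mult k Y)%:R * (z k * psi (X k) (idm (X k))).
Proof.
move=> psiC zetaN zE; have [m [x [inc [prj [h1 h2 h3]]]]] := decomposition Y.
rewrite -(sum_mult h1 h2 h3 (fun k => z k * psi (X k) (idm (X k)))).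
rewrite -[zeta Y]compm1 -h3 compm_sumr linear_sum; apply: eq_bigr => a _.
rewrite compA psiC zetaN (tail2 (h1 a)) comp1m zE linearZ.
by [].
Qed.

End Multiplicities.

(** * Characters of the fusion ring *)

Section FusionCharacters.
Variables (K : numClosedFieldType) (n : nat).
Local Notation I := 'I_n.+1.
Variables (N : I -> I -> I -> nat) (st : I -> I).
Variables (phi : I -> I -> K) (d : I -> K) (sq : K).
Hypothesis phiM : forall a i j, phi a i * phi a j = \sum_k (N i j k)%:R * phi a k.
Hypothesis frob : forall i j k, N i j k = N (st i) k j.
Hypothesis phi_sym : forall a j, d a * phi a j = d j * phi j a.
Hypothesis phi_unit : forall a j, phi a ord0 * phi a j = phi a j.
Hypothesis d_st : forall j, d (st j) = d j.
Let S : 'M[K]_n.+1 := \matrix_(i, j) (d (st i) * phi (st i) j).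
Hypothesis S_unit : S \in unitmx.
Hypothesis sq_sqr : sq ^+ 2 = \sum_i d i ^+ 2.

(** All consequences of nondegeneracy are drawn from the independence of the
    rows of S. *)
Lemma S_free (u : I -> K) :
  (forall j, \sum_i u i * S i j = 0) -> forall i, u i = 0.
Proof.
move=> uS i; have : (\row_i u i) *m S = 0.
  by apply/rowP => j; rewrite !mxE -[RHS](uS j); apply: eq_bigr => l _; rewrite mxE.
move/(congr1 (mulmxr (invmx S))); rewrite /= mulmxK // mul0mx.
by move/rowP/(_ i); rewrite !mxE.
Qed.

Lemma sum_delta i (x : K) (f : I -> K) : \sum_l ((l == i)%:R * x) * f l = x * f i.
Proof.
rewrite (bigD1 i) //= eqxx mul1r big1 ?addr0 // => l li.
by rewrite (negPf li) !mul0r.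
Qed.

Lemma S_row_neq0 i : ~ (forall j, S i j = 0).
Proof.
move=> Si; have := @S_free (fun l => (l == i)%:R * 1) _ i.
rewrite eqxx mulr1 => E; have /eqP := oner_neq0 K; apply; apply: E => j.
by rewrite sum_delta Si mulr0.
Qed.

Lemma S_row_prop i k x y : (forall j, x * S i j = y * S k j) -> x != 0 -> i = k.
Proof.
move=> Sik x0; have [//|ik] := eqVneq i k.
have := @S_free (fun l => (l == i)%:R * x - (l == k)%:R * y) _ i.
rewrite eqxx (negPf ik) mul0r subr0 mul1r => E; case/eqP: x0; apply: E => j.
under eq_bigr do rewrite mulrBl.
by rewrite sumrB !sum_delta Sik subrr.
Qed.

(** Otherwise S would have two equal rows. *)
Lemma st_inj : injective st.
Proof.
move=> i k E; apply: (@S_row_prop i k 1 1); last exact: oner_neq0.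
by move=> j; rewrite !mxE E.
Qed.

Lemma st_onto a : exists i, a = st i.
Proof. by have [g _ gK] := injF_bij st_inj; exists (g a). Qed.

Lemma d_neq0 a : d a != 0.
Proof.
have [i ->] := st_onto a; apply/eqP => d0; apply: (@S_row_neq0 i) => j.
by rewrite mxE d0 mul0r.
Qed.

(** The value at the unit is idempotent; were it 0, the whole character would
    vanish and S would have a zero row. *)
Lemma phi_0 a : phi a ord0 = 1.
Proof.
apply/eqP; rewrite -subr_eq0; apply/negPn/negP => h.
have [i Ei] := st_onto a; apply: (@S_row_neq0 i) => j; rewrite mxE -Ei.
have /eqP : (phi a ord0 - 1) * phi a j = 0 by rewrite mulrBl phi_unit mul1r subrr.
by rewrite mulf_eq0 (negPf h) /= => /eqP ->; rewrite mulr0.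
Qed.

Lemma phi_inj a c : (forall j, phi a j = phi c j) -> a = c.
Proof.
have [i ->] := st_onto a; have [k ->] := st_onto c => E.
congr st; apply: (@S_row_prop i k (d (st k)) (d (st i))); last exact: d_neq0.
by move=> j; rewrite !mxE E; ring.
Qed.

Let P a c := \sum_k phi a k * (phi c k)^*.

(** Multiplication by i on characters is adjoint to multiplication by st i, by
    Frobenius reciprocity: move phi a i into the first factor of P a c and out
    of the second. *)
Lemma phi_adjoint a c i : phi a i * P a c = (phi c (st i))^* * P a c.
Proof.
rewrite /P !mulr_sumr.
transitivity (\sum_j \sum_k (N i j k)%:R * phi a k * (phi c j)^*).
  by apply: eq_bigr => j _; rewrite mulrA phiM mulr_suml.
rewrite exchange_big /=; apply: eq_bigr => k _.
rewrite mulrCA -rmorphM phiM rmorph_sum mulr_sumr; apply: eq_bigr => j _.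
by rewrite rmorphM /= conjC_nat -frob; ring.
Qed.

Lemma P_gt0 a : 0 < P a a.
Proof.
rewrite /P (bigD1 ord0) //= phi_0 mul1r conjC1 ltr_wpDr //.
by apply: sumr_ge0 => k _; apply: mul_conjC_ge0.
Qed.

(** The case a = c of phi_adjoint, as P a a is positive. *)
Lemma phi_st a i : phi a (st i) = (phi a i)^*.
Proof.
by rewrite -[LHS]conjCK; congr (_^*); apply: (mulIf (lt0r_neq0 (P_gt0 a)));
  rewrite -phi_adjoint.
Qed.

(** Two characters with a nonzero pairing agree at all j, by phi_adjoint and
    phi_st. *)
Lemma P_orth a c : a != c -> P a c = 0.
Proof.
move=> ac; apply/eqP/negPn/negP => P0; case/eqP: ac; apply: phi_inj => j.
by apply: (mulIf P0); rewrite phi_adjoint phi_st conjCK.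
Qed.

Let B : 'M[K]_n.+1 := \matrix_(a, j) (d a * phi a j).
Let M a := d a * (d a)^* * P a a.

Lemma B_gram : B *m (map_mx Num.conj B)^T = diag_mx (\row_a M a).
Proof.
apply/matrixP => a c; rewrite !mxE.
transitivity (d a * (d c)^* * P a c).
  rewrite /P mulr_sumr; apply: eq_bigr => k _.
  by rewrite !mxE rmorphM /=; ring.
by have [->|ac] := eqVneq a c; rewrite ?mulr1n // P_orth // mulr0 mulr0n.
Qed.

Lemma M_real a : (M a)^* = M a.
Proof.
rewrite /M !rmorphM /= conjCK [_^* * d a]mulrC; congr (_ * _).
exact/CrealP/gtr0_real/P_gt0.
Qed.

Lemma B_sym : B^T = B.
Proof. by apply/matrixP => a j; rewrite !mxE phi_sym. Qed.

(** B conj(B) is diagonal and, B being symmetric, commutes with B; as the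
    first row of B has no zero entry, it is a scalar. *)
Lemma M_const a : M a = M ord0.
Proof.
pose D := diag_mx (\row_a M a); pose Bc := map_mx Num.conj B.
have E1 : B *m Bc = D by rewrite /D -B_gram map_trmx B_sym.
have E2 : Bc *m B = D.
  have := congr1 (map_mx Num.conj) E1; rewrite map_mxM -map_mx_comp.
  rewrite (map_mx_id (f := Num.conj \o Num.conj)) => [->|x]; last exact: conjCK.
  by apply/matrixP => i j; rewrite !mxE rmorphMn /= M_real.
have : D *m B = B *m D by rewrite -[in LHS]E1 -E2 mulmxA.
move/matrixP/(_ ord0 a); rewrite mul_diag_mx mul_mx_diag !mxE phi_sym phi_0 mulr1.
by rewrite mulrC => /(mulfI (d_neq0 a)).
Qed.

(** As d is invariant under st, so is the row 0 of phi, which is therefore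
    real by phi_st; hence both sides are the sum of the squares of that row
    times the squared norm of d ord0. *)
Lemma M_sq : M ord0 = sq * sq^*.
Proof.
have E0 j : d ord0 * phi ord0 j = d j by rewrite phi_sym phi_0 mulr1.
have phiR j : (phi ord0 j)^* = phi ord0 j.
  by apply: (mulfI (d_neq0 ord0)); rewrite -phi_st !E0 d_st.
have E : sq ^+ 2 = d ord0 ^+ 2 * P ord0 ord0.
  rewrite sq_sqr /P mulr_sumr; apply: eq_bigr => j _.
  by rewrite phiR -[d j]E0; ring.
rewrite -normCK -normrX E normrM normrX normCK.
by rewrite (ger0_norm (ltW (P_gt0 _))).
Qed.

Lemma fusion_characters_unitary :
  (\matrix_(i, j) (S i j / sq)) \is unitarymx.
Proof.
have M0 : M ord0 != 0.
  rewrite /M !mulf_neq0 ?conjC_eq0 ?d_neq0 //; exact: lt0r_neq0 (P_gt0 _).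
apply/unitarymxP/matrixP => i k; rewrite !mxE.
transitivity ((B *m (map_mx Num.conj B)^T) (st i) (st k) / (sq * sq^*)).
  rewrite mxE mulr_suml; apply: eq_bigr => j _; rewrite !mxE.
  by rewrite rmorphM fmorphV invfM /=; ring.
rewrite B_gram !mxE (inj_eq st_inj) M_const -M_sq.
by case: eqP; rewrite ?mulr1n ?mulr0n ?mul0r ?divff.
Qed.

End FusionCharacters.

(** * The S-matrix *)

Section ModularData.
Variables (K : closedFieldType) (C : ribbon_fusion_category K).
Variables (n : nat) (X : simple_reps C n).
Local Notation I := 'I_n.+1.
Implicit Types (i j k : I) (Y Z : C).
Local Notation a X Y Z := (fwd (assoc X Y Z)).
Local Notation c X Y := (fwd (braid X Y)).
Local Notation "1" := (tunit (t := C)).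
Local Notation d i := (cat_dim (X i)).
Local Notation st := (star X).

Lemma ev_zigzag Y : zigzag (ev Y) (coev Y).
Proof. exact: left_dual_zig (left_dualP Y). Qed.

Lemma ev_zagzig Y R :
  cap (ev Y) (dual Y ⊗ R) ∘ (dual Y ◁ cup (coev Y) R) = idm (dual Y ⊗ R).
Proof. exact: left_dual_zag (left_dualP Y) R. Qed.

Definition tr Y (f : mor Y Y) : K := scalar_of (trace (ev Y) (coev Y) f).

Lemma tr_linear Y : scalar (@tr Y).
Proof.
move=> x f g; rewrite /tr /trace tensmDl tensmZl compmDl compmZl compmDr compmZr.
by rewrite linearP.
Qed.
HB.instance Definition _ Y := GRing.isLinear.Build K (mor Y Y) K *%R (@tr Y)
  (@tr_linear Y).

Lemma tr_cyclic Y Z (f : mor Y Z) (g : mor Z Y) : tr (g ∘ f) = tr (f ∘ g).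
Proof. by rewrite /tr (trace_cyclic (ev_zigzag Y) (ev_zigzag Z)). Qed.

(** Cyclicity of the trace for the identity of Y with two different duals. *)
Lemma tr_dualE Y Y' (e : mor (Y' ⊗ Y) 1) (k : mor 1 (Y ⊗ Y')) f :
  zigzag e k -> tr f = scalar_of (trace e k f).
Proof.
move=> z; rewrite /tr -[in LHS](comp1m f) (trace_cyclic (ev_zigzag Y) z).
by rewrite compm1.
Qed.

(** Evaluating the Drinfeld isomorphism against the dual of X undoes the
    coevaluation in its definition: the isomorphism is a mate of the identity
    for the evaluation twisted by a crossing. *)
Lemma cat_dimE Y : cat_dim Y = tr (idm Y).
Proof.
rewrite /cat_dim /tr /trace tensm1 comp1m; congr (scalar_of (_ ∘ _)).
rewrite /spherical wrM compA evrE; congr (_ ∘ _).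
have := mate_ev (ev Y ∘ c Y (dual Y)) (idm (dual Y)) (ev_zigzag (dual Y)).
rewrite tensm1 compm1 => <-; congr (_ ∘ (_ ▷ _)).
rewrite /mate tensm1 comp1m capE /drinfeld wrM -!compA.
by [].
Qed.

Lemma cat_dim_iso Y Z : isomorphic Y Z -> cat_dim Y = cat_dim Z.
Proof.
by case=> u; rewrite !cat_dimE -(bwd_fwd u) tr_cyclic fwd_bwd.
Qed.

(** The scalar by which a loop Y carrying f acts on the strand X i, read off
    with suffix the unit object. *)
Definition encircle_val i Y (f : mor Y Y) : K :=
  let g := encircle (X i) (evr (ev Y) ∘ (f ▷ dual Y)) (coev Y) 1 in
  scalar_of (fwd (runit (X i)) ∘ (g ∘ bwd (runit (X i)))).

Lemma encircle_valE i Y (f : mor Y Y) R :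
  encircle (X i) (evr (ev Y) ∘ (f ▷ dual Y)) (coev Y) R = encircle_val i f *: idm (X i ⊗ R).
Proof.
have [x Ex] := encircle_scalar (evr (ev Y) ∘ (f ▷ dual Y)) (coev Y)
  (@rep_scalar _ _ _ X i).
rewrite Ex /encircle_val Ex compmZl comp1m compmZr fwd_bwd scalar_ofZ1 //.
exact: rep_neq0.
Qed.

Lemma encircle_val_linear i Y : scalar (@encircle_val i Y).
Proof.
move=> x f g; rewrite /encircle_val !encircleE tensmDl tensmZl compmDr compmZr.
rewrite !capE tensmDl tensmZl compmDl compmZl compmDr compmZr tensmDr tensmZr.
by rewrite !(compmDl, compmDr, compmZl, compmZr) linearP.
Qed.
HB.instance Definition _ i Y := GRing.isLinear.Build K (mor Y Y) K *%R (@encircle_val i Y)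
  (@encircle_val_linear i Y).

Lemma encircle_val_cyclic i Y Z (f : mor Y Z) (g : mor Z Y) :
  encircle_val i (g ∘ f) = encircle_val i (f ∘ g).
Proof. by rewrite /encircle_val (encircle_cyclic (ev_zigzag Y) (ev_zigzag Z)). Qed.

(** For fixed i this is a character of the fusion ring, as the next lemmas
    show. *)
Definition fusion_char i Y := encircle_val i (idm Y).

Lemma fusion_charE i Y R :
  encircle (X i) (evr (ev Y)) (coev Y) R = fusion_char i Y *: idm (X i ⊗ R).
Proof. by rewrite -encircle_valE tensm1 compm1. Qed.

Lemma fusion_char_iso i Y Z : isomorphic Y Z -> fusion_char i Y = fusion_char i Z.
Proof. by case=> u; rewrite /fusion_char -(bwd_fwd u) encircle_val_cyclic fwd_bwd. Qed.

Lemma fusion_char_additive i Y : fusion_char i Y = \sum_k (mult X k Y)%:R * fusion_char i (X k).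
Proof.
have := @additive_functional _ _ _ X (fun Z => @encircle_val i Z : {scalar _})
  (fun Z => idm Z) (fun=> 1%R) Y; rewrite /fusion_char => ->.
- by apply: eq_bigr => k _; rewrite mul1r.
- exact: encircle_val_cyclic.
- by move=> ? ? f; rewrite comp1m compm1.
- by move=> k; rewrite scale1r.
Qed.

Lemma ev2_zigzag Y Z : zigzag (ev2 (ev Y) (ev Z)) (coev2 (coev Y) (coev Z)).
Proof. exact: zigzag_ev2 (ev_zigzag Y) (ev_zigzag Z). Qed.

(** The loop formed with the chosen dual of the product agrees with the loop
    formed with nested duals, which is a pair of nested loops. *)
Lemma fusion_char_tens i Y Z : fusion_char i (Y ⊗ Z) = fusion_char i Y * fusion_char i Z.
Proof.
have H := encircle_ev2 (ev Y) (coev Y) (fusion_charE i Z) 1.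
have E := encircle_cyclic (ev_zigzag (Y ⊗ Z)) (ev2_zigzag Y Z) (idm _) (idm _) (X i) 1.
rewrite !compm1 !tensm1 !compm1 H !fusion_charE scalerA in E.
have := congr1 (fun g => scalar_of (fwd (runit (X i)) ∘ (g ∘ bwd (runit (X i))))) E.
rewrite !compmZl !comp1m !compmZr fwd_bwd !scalar_ofZ1; try exact: rep_neq0.
by rewrite mulrC.
Qed.

(** Enough for the value at the unit to be 1 once the character is known not
    to vanish. *)
Lemma fusion_char_unit i j : fusion_char i (X ord0) * fusion_char i (X j) = fusion_char i (X j).
Proof.
rewrite -fusion_char_tens; apply: fusion_char_iso; rewrite rep_one.
split; exact: lunit.
Qed.

(** The Hopf link, evaluated by closing the component X j first. *)
Lemma tr_double_braid i j : tr (c (X j) (X i) ∘ c (X i) (X j)) = d i * fusion_char i (X j).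
Proof.
rewrite (tr_dualE _ (ev2_zigzag (X i) (X j))).
rewrite (trace_ev2 (ev (X i)) (coev (X i)) (fusion_charE i (X j))).
by rewrite linearZ /= -/(tr _) -cat_dimE mulrC.
Qed.

(** The two components of the Hopf link can be exchanged by cyclicity of the
    trace. *)
Lemma fusion_char_sym i j : d i * fusion_char i (X j) = d j * fusion_char j (X i).
Proof. by rewrite -!tr_double_braid tr_cyclic. Qed.

Lemma theta_scalar i : fwd (twist (X i)) = theta X i *: idm (X i).
Proof. exact: scalar_ofE. Qed.

Lemma theta_neq0 i : theta X i != 0.
Proof.
apply/eqP => E; apply: (@rep_neq0 _ _ _ X i).
by rewrite -(bwd_fwd (twist (X i))) theta_scalar E scale0r compm0.
Qed.

Lemma twist_dual_rep i : fwd (twist (dual (X i))) = theta X i *: idm (dual (X i)).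
Proof.
rewrite twist_dual theta_scalar /dualm tensmZr tensm1 tensmZl tensm1.
rewrite compmZr compm1 !compmZl; congr (_ *: _).
by have [_ ->] := left_dualP (X i); rewrite fwd_bwd.
Qed.

(** The twist of a dual is the transpose of the twist, and the transpose of a
    scalar is the same scalar. *)
Lemma theta_star i : theta X (st i) = theta X i.
Proof.
have [u] := rep_star X i; rewrite /theta -[RHS](@scalar_ofZ1 _ _ (X (st i))).
  congr scalar_of; apply: (iso_epi (u := u)).
  by rewrite twist_nat twist_dual_rep compmZl comp1m compmZr compm1.
exact: rep_neq0.
Qed.

(** The dimension of the dual X' may be computed with X as its dual, by
    zigzag_flip. The inverse crossing in that duality cancels a crossing in
    the right evaluation, and the result is the trace of X. *)
Lemma d_star i : d (st i) = d i.
Proof.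
rewrite -(cat_dim_iso (rep_star X i)) !cat_dimE.
have z := zigzag_flip (ev_zagzig (X i)).
rewrite (tr_dualE _ z) /tr /trace !evrE !tensm1 !comp1m twist_dual_rep theta_scalar.
rewrite !tensmZl !tensm1 !compmZr !compm1 !compmZl -!compA.
by rewrite fbK.
Qed.

(** The sum in the definition is the trace of the twist on a tensor product,
    by additivity of the trace; the balancing axiom makes it a multiple of the
    trace of the double braiding. *)
Lemma stildeE i j : stilde X i j = d (st i) * fusion_char (st i) (X j).
Proof.
rewrite mxE -tr_double_braid; set Y := X (st i) ⊗ X j.
have <- : tr (fwd (twist Y)) =
    \sum_k (\dim {: mor (X k) Y})%:R * theta X k * cat_dim (X k).
  have := @additive_functional _ _ _ X (fun Z => @tr Z : {scalar _})
    (fun Z => fwd (twist Z)) (theta X) Y => /= ->.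
  - by apply: eq_bigr => k _; rewrite cat_dimE mulrA.
  - exact: tr_cyclic.
  - by move=> Z Z' f; rewrite twist_nat.
  - exact: theta_scalar.
rewrite twist_tens !theta_scalar tensmZl tensmZr tensm1 !compmZr compm1 !linearZ /=.
rewrite theta_star; have := theta_neq0 i; have := theta_neq0 j.
by move=> tj ti; field; rewrite ti tj.
Qed.

Definition wlmap W Y Z (f : mor Y Z) : mor (W ⊗ Y) (W ⊗ Z) := W ◁ f.
Lemma wlmap_linear W Y Z : linear (@wlmap W Y Z).
Proof. exact: tensm_linear_r. Qed.
HB.instance Definition _ W Y Z :=
  GRing.isLinear.Build K (mor Y Z) (mor (W ⊗ Y) (W ⊗ Z)) *:%R (@wlmap W Y Z)
    (@wlmap_linear W Y Z).

(** Bending the strand Y down and up again are inverse to each other by the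
    two zigzags. *)
Lemma dim_adjunction Y Z W :
  \dim {: mor Z (Y ⊗ W)} = \dim {: mor (dual Y ⊗ Z) W}.
Proof.
apply/eqP; rewrite eqn_leq; apply/andP; split.
  apply: (dim_inj (f := postcomp (cap (ev Y) W) \o @wlmap (dual Y) Z (Y ⊗ W))).
  apply: (can_inj (g := fun g => (Y ◁ g) ∘ cup (coev Y) Z)) => f.
  by rewrite /= /postcomp /wlmap wlM -compA -cupN compA ev_zigzag comp1m.
apply: (dim_inj (f := precomp (cup (coev Y) Z) \o @wlmap Y (dual Y ⊗ Z) W)).
apply: (can_inj (g := fun g => cap (ev Y) W ∘ (dual Y ◁ g))) => f.
by rewrite /= /precomp /wlmap wlM compA capN -compA ev_zagzig compm1.
Qed.

(** Adjunction, followed by semisimplicity to exchange source and target. *)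
Lemma frobenius i j k : mult X k (X i ⊗ X j) = mult X j (X (st i) ⊗ X k).
Proof.
have [u] := rep_star X i.
rewrite /mult dim_adjunction (dim_iso_l _ (wr_iso (X k) u)).
exact: mult_dual.
Qed.

End ModularData.

Lemma Smatrix_unitary (K : numClosedFieldType) (C : modular_category K) :
  Smatrix C \is unitarymx.
Proof.
set X := simples C.
have E : stilde X = \matrix_(i, j)
    (cat_dim (X (star X i)) * fusion_char X (star X i) (X j)).
  by apply/matrixP => i j; rewrite stildeE mxE.
have := @fusion_characters_unitary K _ (fun i j k => mult X k (X i ⊗ X j)) (star X)
  (fun i j => fusion_char X i (X j)) (fun i => cat_dim (X i)) (sqrtD C).
rewrite /Smatrix -/X E; apply.
- by move=> i j k; rewrite -fusion_char_tens fusion_char_additive.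
- exact: frobenius.
- exact: fusion_char_sym.
- exact: fusion_char_unit.
- exact: d_star.
- by rewrite -E; apply: stilde_nondegenerate.
- exact: sqrtD_sqr.
Qed.

(** * The T-matrix *)

Section Vafa.
Variables (K : numClosedFieldType) (C : ribbon_fusion_category K).
Variables (n : nat) (X : simple_reps C n).
Local Notation I := 'I_n.+1.
Implicit Types (i j k : I) (A B W Y Z P : C).
Local Notation a X Y Z := (fwd (assoc X Y Z)).
Local Notation a' X Y Z := (bwd (assoc X Y Z)).
Local Notation c X Y := (fwd (braid X Y)).
Local Notation th X := (fwd (twist X)).
Local Notation t := (theta X).

(** A bound on the spectrum of g stated through eigenvectors in all morphism
    spaces, so that it passes to conjugates of g and bounds the determinant of
    composition with g. *)
Definition twist_spectrum P (g : mor P P) :=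
  forall W (f : mor W P) x, f != 0 -> g ∘ f = x *: f -> exists k, x = t k.

(** Some component of f along the decomposition of Y is nonzero, and on it the
    twist acts by the twist of a simple object. *)
Lemma twist_spectrum_wr Y Z : twist_spectrum (th Y ▷ Z).
Proof.
move=> W f x f0 gf; have [m [y [inc [prj [h1 h2 h3]]]]] := decomposition X Y.
have [b pf0] : exists b, (prj b ▷ Z) ∘ f != 0.
  apply/existsP; rewrite -negb_forall; apply: contra f0 => /forallP pf0.
  have -> : f = \sum_b (inc b ▷ Z) ∘ ((prj b ▷ Z) ∘ f).
    rewrite -[LHS]comp1m -tensm1 -h3.
    rewrite (big_morph (fun g => g ▷ Z) (id1 := 0) (op1 := +%R)).
    - by rewrite compm_suml; apply: eq_bigr => b _; rewrite wrM compA.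
    - by move=> u v; rewrite tensmDl.
    - by rewrite tens0m.
  by rewrite big1 // => b _; rewrite (eqP (pf0 b)) compm0.
exists (y b); apply/eqP; rewrite -subr_eq0; apply: contraR pf0 => xt.
rewrite -(inj_eq (scalerI xt)) scaler0 scalerBl subr_eq0; apply/eqP.
rewrite -compmZr -gf (tail2 (esym (wrM _ _ _))) -twist_nat theta_scalar.
by rewrite compmZl comp1m tensmZl compmZl.
Qed.

Lemma twist_spectrum_conj P Q (u : iso P Q) (g : mor Q Q) :
  twist_spectrum g -> twist_spectrum (bwd u ∘ (g ∘ fwd u)).
Proof.
move=> gs W f x f0 E; apply: (gs W (fwd u ∘ f)).
  by apply: contra f0 => /eqP uf; rewrite -(bfK u f) uf compm0.
by rewrite -compmZr -E -!compA fbK.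
Qed.

(** Conjugate by the braiding. *)
Lemma twist_spectrum_wl Y Z : twist_spectrum (Z ◁ th Y).
Proof.
have := twist_spectrum_conj (u := braid Z Y) (@twist_spectrum_wr Y Z).
by rewrite -braid_wl bfK.
Qed.

Lemma cr_iso_bf A B Z : suf (bwd (braid A B)) Z ∘ cr A B Z = idm _.
Proof. by rewrite /cr -sufM bwd_fwd suf1. Qed.
Lemma cr_iso_fb A B Z : cr A B Z ∘ suf (bwd (braid A B)) Z = idm _.
Proof. by rewrite /cr -sufM fwd_bwd suf1. Qed.
Definition cr_iso A B Z := Iso (cr_iso_bf A B Z) (cr_iso_fb A B Z).

Lemma braid_tensr A B Z :
  c A (B ⊗ Z) = a' B Z A ∘ ((B ◁ c A Z) ∘ cr A B Z).
Proof.
apply: (iso_epi (u := assoc A B Z)); apply: (iso_mono (u := assoc B Z A)).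
have := hexagon1 A B Z; rewrite -!compA => ->.
by rewrite fbK /cr sufE -?compA bwd_fwd compm1.
Qed.

Lemma braid_tensl A B Z :
  c (B ⊗ Z) A = cr B A Z ∘ ((B ◁ c Z A) ∘ a B Z A).
Proof.
apply: (iso_epi (u := iso_sym (assoc B Z A))).
apply: (iso_mono (u := iso_sym (assoc A B Z))) => /=.
have := hexagon2 B Z A; rewrite -!compA => ->.
by rewrite fwd_bwd compm1 /cr sufE -?compA bfK.
Qed.

(** The full twist on three strands is the product of full twists on the three
    pairs, the outer strands being made adjacent by conjugation with a
    crossing, divided by one twist per strand. As the dual of X i has the same
    twist as X i, each of the three strands has twist t i. *)
Lemma lantern i : let A := X i in let B := dual A in
  exists g1 g2 g3 : mor (A ⊗ (B ⊗ A)) (A ⊗ (B ⊗ A)),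
  [/\ twist_spectrum g1, twist_spectrum g2, twist_spectrum g3
    & t i ^+ 3 *: th (A ⊗ (B ⊗ A)) = g1 ∘ (g2 ∘ g3)].
Proof.
move=> A B; pose u := cr_iso A B A.
exists (a A B A ∘ ((th (A ⊗ B) ▷ A) ∘ a' A B A)),
  (bwd u ∘ ((B ◁ th (A ⊗ A)) ∘ fwd u)), (A ◁ th (B ⊗ A)); split.
- exact: (twist_spectrum_conj (u := iso_sym (assoc A B A)) (@twist_spectrum_wr _ _)).
- exact: twist_spectrum_conj (@twist_spectrum_wl _ _).
- exact: twist_spectrum_wl.
have thA : th A = t i *: idm A := theta_scalar X i.
have thB : th B = t i *: idm B := twist_dual_rep X i.
have E1 : a A B A ∘ ((th (A ⊗ B) ▷ A) ∘ a' A B A) = t i ^+ 2 *: (cr B A A ∘ fwd u).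
  rewrite -sufE twist_tens thA thB tensmZl tensmZr tensm1 !compmZr compm1.
  by rewrite !sufZ sufM scalerA -expr2.
have E2 : t i ^+ 2 *: (c A A ∘ c A A) = th (A ⊗ A).
  by rewrite twist_tens thA tensmZl tensmZr tensm1 !compmZr compm1 scalerA -expr2.
apply: (scalerI (theta_neq0 X i)); rewrite scalerA -exprS.
rewrite E1 -E2 twist_tens thA tensE tensmZl tensm1 compmZl comp1m.
rewrite braid_tensr braid_tensl -?compA fbK.
rewrite !(compmZl, compmZr, tensmZr) wlM -?compA fbK /= !scalerA.
by congr (_ *: _); ring.
Qed.

(* Applied below with h the absolute value and with h its inverse. *)
Section Maximum.
Variable h : K -> K.
Hypotheses (h_ge0 : forall x, 0 <= h x) (h1 : h 1 = 1)
  (hM : forall x y, h (x * y) = h x * h y).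

Lemma hX x m : h (x ^+ m) = h x ^+ m.
Proof. by elim: m => [|m IH]; rewrite ?expr0 ?h1 // !exprS hM IH. Qed.

Lemma h_max : exists i, forall j, h (t j) <= h (t i).
Proof.
have [i iP] : exists i, forall j, j \in enum I -> h (t j) <= h (t i).
  elim: (enum I) => [|k s [i IH]]; first by exists ord0.
  have := real_leVge (ger0_real (h_ge0 (t k))) (ger0_real (h_ge0 (t i))).
  case/orP => ki; [exists i | exists k] => j; rewrite inE => /predU1P[->|/IH] //.
  by move/le_trans; apply.
by exists i => j; apply: iP; rewrite mem_enum.
Qed.

(** The determinant is the product of the eigenvalues, each of which is a
    twist. *)
Lemma h_lfdet i W P (g : mor P P) : (forall j, h (t j) <= h (t i)) ->
  twist_spectrum g ->
  h (lfdet (linfun (@postcomp _ _ W _ _ g))) <= h (t i) ^+ \dim {: mor W P}.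
Proof.
move=> ti gs; have [s <- [-> sP]] := lfdet_eigen (linfun (@postcomp _ _ W _ _ g)).
have {sP} : forall x, x \in s -> h x <= h (t i).
  move=> x /sP[f f0]; rewrite lfunE => /(gs _ _ _ f0)[k ->]; exact: ti.
elim: s => [|x s IH] sP; first by rewrite big_nil h1 expr0.
rewrite big_cons hM exprS ler_pM //; first by apply: sP; rewrite mem_head.
by apply: IH => y ys; apply: sP; rewrite inE ys orbT.
Qed.

(** The coevaluation tensored with A is nonzero, for the zigzag equation
    recovers the identity of A from it. *)
Lemma hom_coev_neq0 i (A := X i) :
  (0 < \dim {: mor A (A ⊗ (dual A ⊗ A))})%N.
Proof.
rewrite lt0n dimv_eq0; apply/eqP => V0.
have E0 : forall f : mor A (A ⊗ (dual A ⊗ A)), f = 0.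
  by move=> f; apply/eqP; rewrite -memv0 -V0 memvf.
apply: (@rep_neq0 _ _ _ X i); rewrite -/A.
have [H _] := left_dualP A; rewrite -(fwd_bwd (lunit A)) -H -!compA.
by rewrite [fwd (assoc _ _ _) ∘ _]E0 !compm0.
Qed.

(** Taking h of determinants in the lantern relation, with h (t i) maximal,
    gives h (t i) ^ 4N <= h (t i) ^ 3N. *)
Lemma h_twist_le1 j : h (t j) <= 1.
Proof.
have [i ti] := h_max; apply: le_trans (ti j) _.
have [g1 [g2 [g3 [s1 s2 s3 E]]]] := lantern i.
set A := X i in g1 g2 g3 s1 s2 s3 E; set P := A ⊗ _ in g1 g2 g3 s1 s2 s3 E.
pose L g := linfun (@postcomp _ _ A P P g).
have LE : (L g1 \o (L g2 \o L g3))%VF = (t i ^+ 4 *: \1)%VF.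
  apply/lfunP => f; rewrite /L !comp_lfunE !lfunE /= !lfunE /= /postcomp.
  rewrite 2!compA -[(_ ∘ g2) ∘ _]compA -E compmZl twist_nat theta_scalar.
  by rewrite compmZr compm1 scalerA -exprSr.
have := congr1 (fun f => h (lfdet f)) LE; rewrite !lfdet_comp !hM lfdetZ1 !hX.
set N := \dim _ => EN.
have N0 : (0 < N)%N := hom_coev_neq0 i.
have h0 : 0 < h (t i).
  rewrite lt0r h_ge0 andbT; apply/eqP => hi; have /eqP := oner_neq0 K; apply.
  by rewrite -h1 -(divff (theta_neq0 X i)) hM hi mul0r.
have : (h (t i) ^+ 4) ^+ N <= (h (t i) ^+ 3) ^+ N.
  rewrite -EN !exprS expr0 mulr1 !exprMn.
  rewrite ler_pM ?mulr_ge0 ?h_ge0 ?h_lfdet //.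
  by rewrite ler_pM ?h_ge0 ?h_lfdet.
rewrite ler_pXn2r // ?nnegrE ?exprn_ge0 ?h_ge0 //.
by rewrite exprS ger_pMl ?exprn_gt0.
Qed.

End Maximum.

Lemma twist_norm1 j : `|t j| = 1.
Proof.
apply/eqP; rewrite eq_le; apply/andP; split.
  apply: (@h_twist_le1 (fun x => `|x|)) => //; [exact: normr1 | exact: normrM].
rewrite -[`|t j|]invrK invr_ge1 ?unitfE ?invr_eq0 ?normr_eq0 ?theta_neq0 //.
- apply: (@h_twist_le1 (fun x => `|x|^-1)) => [x||x y].
  + by rewrite invr_ge0.
  + by rewrite normr1 invr1.
  + by rewrite normrM invfM.
- by rewrite invr_gt0 normr_gt0 theta_neq0.
Qed.

End Vafa.

Lemma Tmatrix_unitary (K : numClosedFieldType) (C : modular_category K) :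
  Tmatrix C \is unitarymx.
Proof.
apply/unitarymxP; rewrite /Tmatrix; apply/matrixP => i j.
rewrite mul_diag_mx !mxE [j == i]eq_sym; case: eqP => [->|_]; last first.
  by rewrite mulr0n rmorph0 mulr0.
by rewrite mulr1n -normCK twist_norm1 expr1n.
Qed.

(** * Generation of SL_2(Z) *)

Definition mx2 (a b c d : int) : 'M[int]_2 :=
  \matrix_(i, j) nth 0 (nth [::] [:: [:: a; b]; [:: c; d]] i) j.

Lemma mx2_eta (g : 'M[int]_2) : g = mx2 (g 0 0) (g 0 1) (g 1 0) (g 1 1).
Proof.
apply/matrixP => i j; rewrite !mxE.
by case: i j => [[|[|//]] i2] [[|[|//]] j2] /=; congr (g _ _); apply: val_inj.
Qed.

Lemma mx2M a b c d a' b' c' d' :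
  mx2 a b c d *m mx2 a' b' c' d' =
  mx2 (a * a' + b * c') (a * b' + b * d') (c * a' + d * c') (c * b' + d * d').
Proof.
apply/matrixP => i j; rewrite !mxE !big_ord_recl big_ord0 !mxE addr0.
by case: i j => [[|[|//]] i2] [[|[|//]] j2].
Qed.

Lemma det_mx2 a b c d : \det (mx2 a b c d) = a * d - b * c.
Proof.
rewrite (expand_det_row _ ord0) !big_ord_recl big_ord0 addr0 /cofactor !det_mx11.
by rewrite !mxE /= expr0 expr1; ring.
Qed.

Section Generation.
Variable Q : 'M[int]_2 -> Prop.
Hypothesis QM : forall g h, SL2Z g -> SL2Z h -> Q g -> Q h -> Q (g *m h).
Hypothesis QV : forall g, SL2Z g -> Q g -> Q (invmx g).
Hypotheses (Qs : Q sl2_s) (Qt : Q sl2_t).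

Lemma SL2Z_unit g : SL2Z g -> g \in unitmx.
Proof. by rewrite unitmxE => ->; apply: unitr1. Qed.

Lemma SL2Z_M g h : SL2Z g -> SL2Z h -> SL2Z (g *m h).
Proof. by rewrite /SL2Z det_mulmx => -> ->; rewrite mulr1. Qed.

Lemma SL2Z_V g : SL2Z g -> SL2Z (invmx g).
Proof. by rewrite /SL2Z det_inv => ->; rewrite invr1. Qed.

Lemma SL2Z_s : SL2Z sl2_s.
Proof. by rewrite /SL2Z (det_mx2 0 (-1) 1 0). Qed.
Lemma SL2Z_t : SL2Z sl2_t.
Proof. by rewrite /SL2Z (det_mx2 1 1 0 1). Qed.

Lemma SL2Z_shear k : SL2Z (mx2 1 k 0 1).
Proof. by rewrite /SL2Z det_mx2; ring. Qed.

Lemma invmx_shear k : invmx (mx2 1 k 0 1) = mx2 1 (- k) 0 1.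
Proof.
rewrite -[RHS]mul1mx -(mulVmx (SL2Z_unit (SL2Z_shear k))) -mulmxA mx2M.
by rewrite -[LHS]mulmx1; congr (_ *m _); apply/matrixP => i j; rewrite !mxE;
  case: i j => [[|[|//]] i2] [[|[|//]] j2] //=; ring.
Qed.

Lemma Q_shear k : Q (mx2 1 k 0 1).
Proof.
have Qn (m : nat) : Q (mx2 1 m%:Z 0 1).
  elim: m => [|m IH].
    have -> : mx2 1 0%N%:Z 0 1 = sl2_t *m invmx sl2_t.
      rewrite mulmxV ?SL2Z_unit //; last exact: SL2Z_t.
      by apply/matrixP => i j; rewrite !mxE;
        case: i j => [[|[|//]] i2] [[|[|//]] j2].
    apply: QM (QV _ Qt) => //; [exact: SL2Z_t|exact: SL2Z_V SL2Z_t|exact: SL2Z_t].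
  have -> : mx2 1 m.+1%:Z 0 1 = sl2_t *m mx2 1 m%:Z 0 1.
    by rewrite (mx2M 1 1 0 1); congr mx2; rewrite ?intS; ring.
  exact: QM SL2Z_t (SL2Z_shear _) Qt IH.
case: k => m; first exact: Qn.
rewrite NegzE -invmx_shear; exact: QV (SL2Z_shear _) (Qn _).
Qed.

Lemma Q_opp g : SL2Z g -> Q g -> Q (- g).
Proof.
move=> Sg Qg; have -> : - g = (sl2_s *m sl2_s) *m g.
  rewrite (mx2M 0 (-1) 1 0) [in RHS](mx2_eta g) mx2M [in LHS](mx2_eta g).
  apply/matrixP => i j; rewrite !mxE.
  by case: i j => [[|[|//]] i2] [[|[|//]] j2] //=; ring.
have Ss := SL2Z_s; by apply: QM => //; [exact: SL2Z_M | exact: QM].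
Qed.

(** Euclid's algorithm: with q the quotient of a by c, a shear and a rotation
    replace the lower left entry c by the remainder of a modulo c. *)
Lemma SL2Z_generated g : SL2Z g -> Q g.
Proof.
rewrite (mx2_eta g); move: (g 0 0) (g 0 1) (g 1 0) (g 1 1) => a b c d.
have [m] := ubnP `|c|%N; elim: m => // m IH in a b c d * => cm Sg.
have := Sg; rewrite /SL2Z det_mx2 => det1.
have [c0|c0] := eqVneq c 0.
  rewrite c0 mulr0 subr0 in det1; subst c.
  have [[-> ->]|[-> ->]] : (a = 1 /\ d = 1) \/ (a = -1 /\ d = -1).
    have /eqP := congr1 absz det1; rewrite abszM muln_eq1 => /andP[/eqP a1 /eqP d1].
    by nia.
  - exact: Q_shear.
  - have -> : mx2 (-1) b 0 (-1) = - mx2 1 (- b) 0 1.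
      apply/matrixP => i j; rewrite !mxE.
      by case: i j => [[|[|//]] i2] [[|[|//]] j2] //=; ring.
    exact: Q_opp (SL2Z_shear _) (Q_shear _).
pose q := (a %/ c)%Z; pose r := (a %% c)%Z.
have Ea : a = q * c + r := divz_eq a c.
have Ss := SL2Z_s; have St := SL2Z_shear q.
have -> : mx2 a b c d = mx2 1 q 0 1 *m
    (invmx sl2_s *m mx2 (- c) (- d) r (b - q * d)).
  have -> : mx2 (- c) (- d) r (b - q * d) = sl2_s *m mx2 r (b - q * d) c d.
    by rewrite (mx2M 0 (-1) 1 0); congr mx2; ring.
  by rewrite mulKmx ?SL2Z_unit // mx2M; congr mx2; rewrite ?Ea; ring.
have Sg' : SL2Z (mx2 (- c) (- d) r (b - q * d)).
  by rewrite /SL2Z det_mx2 -det1 Ea; ring.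
apply: QM => //; [exact: SL2Z_M (SL2Z_V Ss) Sg' | exact: Q_shear |].
apply: QM => //; [exact: SL2Z_V | exact: QV | apply: IH => //].
have := modz_ge0 a c0; have := ltz_mod a c0; rewrite -/r => r1 r2.
apply: leq_trans (_ : `|c|%N <= m)%N; last by rewrite -ltnS.
by rewrite -ltz_nat gez0_abs // abszE.
Qed.

End Generation.

Section UnitaryRep.
Variables (K : numClosedFieldType) (n : nat) (rho : 'M[int]_2 -> 'M[K]_n).
Hypothesis rhoP : projective_rep rho.

Let uni g := exists2 U : 'M[K]_n, U \is unitarymx & proj_eq (rho g) U.

Lemma uni_mul g h : SL2Z g -> SL2Z h -> uni g -> uni h -> uni (g *m h).
Proof.
move=> Sg Sh [U Uu [x x0 Ex]] [V Vu [y y0 Ey]].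
exists (U *m V); first exact: mul_unitarymx.
have [z z0 Ez] := rhoP.2 g h Sg Sh; exists (z * (x * y)).
  by rewrite !mulf_neq0.
by rewrite Ez Ex Ey -scalemxAl -scalemxAr !scalerA mulrA.
Qed.

(** rho sends the identity to a scalar matrix, because its value there is
    invertible and proportional to its square; so rho maps inverses to
    inverses up to scalars. *)
Lemma uni_inv g : SL2Z g -> uni g -> uni (invmx g).
Proof.
move=> Sg [U Uu [x x0 Ex]]; have Sg' := SL2Z_V Sg.
have S1 : SL2Z (1%:M) by rewrite /SL2Z det1.
have [y y0 Ey] : proj_eq (rho 1%:M) 1%:M.
  have [y y0 Ey] := rhoP.2 _ _ S1 S1; have u1 := rhoP.1 _ S1.
  exists y^-1; first by rewrite invr_eq0.
  rewrite mulmx1 in Ey; have := congr1 (mulmx (invmx (rho 1%:M))) Ey.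
  rewrite mulVmx // -scalemxAr mulKmx // => ->.
  by rewrite scalerA mulVf // scale1r.
have [z z0] := rhoP.2 _ _ Sg Sg'; rewrite mulmxV ?SL2Z_unit // Ey Ex => E.
exists (invmx U); first by rewrite invmx_unitary // trmxC_unitary.
exists (y / (z * x)); first by rewrite !mulf_neq0 ?invr_eq0 ?mulf_neq0.
have UU : invmx U *m U = 1%:M.
  by rewrite mulVmx // unitarymx_unit.
have := congr1 (mulmx (invmx U)) E.
rewrite -!scalemxAr mulmx1 -scalemxAl -scalemxAr mulmxA UU mul1mx scalerA.
move=> E'; rewrite mulrC -scalerA E' scalerA mulVf ?scale1r //.
by rewrite mulf_neq0.
Qed.

Lemma unitary_rep_generators : uni sl2_s -> uni sl2_t -> unitary_rep rho.
Proof.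
by move=> us ut g Sg; apply: (SL2Z_generated (Q := uni)) => //;
  [exact: uni_mul | exact: uni_inv].
Qed.

End UnitaryRep.

Unset Implicit Arguments.

Theorem proposition2p12 (R : realType) (C : modular_category (complex R)) :
  (forall rho : 'M[int]_2 -> 'M[complex R]_((rank_pred C).+1),
     associated_rep rho -> unitary_rep rho) /\
  (Smatrix C \is unitarymx /\ Tmatrix C \is unitarymx).
Proof.
have US := Smatrix_unitary C; have UT := Tmatrix_unitary C.
split; last exact: conj US UT.
move=> rho [rhoP rs rt].
refine (@unitary_rep_generators _ _ rho rhoP _ _).
- by exists (Smatrix C); [exact: US | exact: rs].
- by exists (Tmatrix C); [exact: UT | exact: rt].
Qed.
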